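(* Let $Q$ be a quiver with finite vertex set $Q_0$ and let $\mathscr{R}=(\{\mathscr{C}_x\}_{x\in Q_0\cup Q_1},\{S_a,T_a\}_{a\in Q_1})$ be a Hausdorff linearly topologized pseudo-abelian categorical realization of $Q$ such that, for every $v\in Q_0$ and every $C\in\mathscr{C}_v$, the ring $\mathrm{End}_{\mathscr{C}_v}(C)$ is semiperfect and has Fitting's Property. Then $\mathrm{Rep}(Q,\mathscr{R})$ is a Hausdorff linearly topologized pseudo-abelian category, and for every $\rho\in\mathrm{Rep}(Q,\mathscr{R})$ the ring $\mathrm{End}(\rho)$ is semiperfect and has Fitting's Property. In particular, $\mathrm{Rep}(Q,\mathscr{R})$ is a Krull-Schmidt category.
   Context: Rings are unital and ring homomorphisms preserve the unity; $\mathrm{Jac}(R)$ is the Jacobson radical. **Quivers and realizations.** A quiver $Q$ is a directed graph (loops and multiple edges allowed) with vertex set $Q_0$, always assumed finite, and edge set $Q_1$, possibly infinite; $s(a)$, $t(a)$ are the source and target of an edge $a$. A categorical realization $\mathscr{R}=(\{\mathscr{C}_x\}_{x\in Q_0\cup Q_1},\{S_a,T_a\}_{a\in Q_1})$ of $Q$ consists of an additive category $\mathscr{C}_v$ for each $v\in Q_0$, and, for each $a\in Q_1$, an additive category $\mathscr{C}_a$ and additive functors $S_a:\mathscr{C}_{s(a)}\to\mathscr{C}_a$, $T_a:\mathscr{C}_{t(a)}\to\mathscr{C}_a$. A representation of $Q$ on $\mathscr{R}$ is a pair $(\{C_v\}_{v\in Q_0},\{f_a\}_{a\in Q_1})$ with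 $C_v\in\mathscr{C}_v$ and $f_a\in\mathrm{Hom}_{\mathscr{C}_a}(S_aC_{s(a)},T_aC_{t(a)})$. A morphism $(\{C_v\},\{f_a\})\to(\{C'_v\},\{f'_a\})$ is a family $\{\psi_v\}_{v\in Q_0}$ with $\psi_v\in\mathrm{Hom}_{\mathscr{C}_v}(C_v,C'_v)$ and $T_a\psi_{t(a)}\circ f_a=f'_a\circ S_a\psi_{s(a)}$ for all $a\in Q_1$. The resulting category is $\mathrm{Rep}(Q,\mathscr{R})$. **Pseudo-abelian and Krull-Schmidt.** An additive category $\mathscr{C}$ is pseudo-abelian if for every $C\in\mathscr{C}$ and every idempotent $e\in\mathrm{End}_{\mathscr{C}}(C)$ there are an object $S$ and morphisms $i:S\to C$, $p:C\to S$ with $i\circ p=e$, $p\circ i=\mathrm{id}_S$. The realization $\mathscr{R}$ is pseudo-abelian if each $\mathscr{C}_v$, $v\in Q_0$, is pseudo-abelian. An object $C$ has a Krull-Schmidt decomposition if $C=C_1\oplus\dots\oplus C_t$ with all $C_i$ indecomposable, and for any other such decomposition $C=C'_1\oplus\dots\oplus C'_{t'}$ one has $t=t'$ and $C_i\cong C'_i$ after reordering. A pseudo-abelian category is a Krull-Schmidt category if every object has a Krull-Schmidt decomposition. A ring $R$ is semiperfect if there are pairwise orthogonal idempotents $e_1,\dots,e_t$ with $\sum_i e_i=1$ and every $e_iRe_i$ local (equivalently, $R$ is semilocal and idempotents lift modulo $\mathrm{Jac}(R)$). **Linear topologies.** A topological ring is linearly topologized (LT) if it has a basis of neighborhoods of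 $0$ consisting of two-sided ideals. An ideal $I$ of an additive category $\mathscr{C}$ assigns to every $X,Y\in\mathscr{C}$ an additive subgroup $I(X,Y)\subseteq\mathrm{Hom}_{\mathscr{C}}(X,Y)$ with $\mathrm{Hom}_{\mathscr{C}}(Y,Y')\circ I(X,Y)\circ\mathrm{Hom}_{\mathscr{C}}(X',X)\subseteq I(X',Y')$ for all $X',Y'$; write $I(X)=I(X,X)$. An LT category is a pair $(\mathscr{C},\mathcal{I}_{\mathscr{C}})$ with $\mathscr{C}$ additive and $\mathcal{I}_{\mathscr{C}}$ a nonempty collection of ideals of $\mathscr{C}$ such that for all $I,J\in\mathcal{I}_{\mathscr{C}}$ there is $K\in\mathcal{I}_{\mathscr{C}}$ with $K(X,Y)\subseteq I(X,Y)\cap J(X,Y)$ for all $X,Y$. The cosets $f+I(X,Y)$ then generate a topology on $\mathrm{Hom}_{\mathscr{C}}(X,Y)$, and $\mathrm{End}_{\mathscr{C}}(X)$ is an LT ring with basis $\{I(X)\}_{I\in\mathcal{I}_{\mathscr{C}}}$ of neighborhoods of $0$. The LT category is Hausdorff if $\bigcap_{I\in\mathcal{I}_{\mathscr{C}}}I(X,Y)=0$ for all $X,Y$. The realization $\mathscr{R}$ is LT if each $\mathscr{C}_v$ ($v\in Q_0$) is an LT category, with linear topology $\mathcal{I}_v$. In that case $\mathrm{Rep}(Q,\mathscr{R})$ is regarded as an LT category via the ideals indexed by families $I=\{I_v\}_{v\in Q_0}$, $I_v\in\mathcal{I}_v$, given for $\rho=(\{C_v\},\{f_a\})$, $\rho'=(\{C'_v\},\{f'_a\})$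 by $I(\rho,\rho')=\mathrm{Hom}(\rho,\rho')\cap\prod_{v\in Q_0}I_v(C_v,C'_v)$. An LT realization $\mathscr{R}$ is Hausdorff if each $\mathscr{C}_v$ ($v\in Q_0$) is Hausdorff and for all $a\in Q_1$, $C\in\mathscr{C}_{s(a)}$, $C'\in\mathscr{C}_{t(a)}$, $$\bigcap_{I\in\mathcal{I}_{s(a)},\ I'\in\mathcal{I}_{t(a)}}\Big(T_aI'(C')\circ\mathrm{Hom}_{\mathscr{C}_a}(S_aC,T_aC')+\mathrm{Hom}_{\mathscr{C}_a}(S_aC,T_aC')\circ S_aI(C)\Big)=0,$$ where $T_aI'(C')=\{T_af: f\in I'(C')\}$, $S_aI(C)=\{S_ag:g\in I(C)\}$, and a product such as $T_aI'(C')\circ H$ denotes the additive subgroup generated by the composites. **Fitting's Property.** A Hausdorff LT ring $R$ has Fitting's Property if for every $n\ge 1$ and $a\in\mathrm{M}_n(R)$ (with the product topology of $R^{n^2}$) there is an idempotent $e\in\mathrm{M}_n(R)$ such that $a=eae+(1-e)a(1-e)$, $eae$ is invertible in $e\mathrm{M}_n(R)e$, and $(1-e)a^k(1-e)\to0$ as $k\to\infty$. For an object $X$ of an LT category $(\mathscr{C},\mathcal{I}_{\mathscr{C}})$, the endomorphism ring $\mathrm{End}_{\mathscr{C}}(X)$ carries the linear ring topology in which $\{I(X)\}_{I\in\mathcal{I}_{\mathscr{C}}}$ is a basis of neighborhoods of $0$; in particular, for $\rho=(\{C_v\},\{f_a\})\in\mathrm{Rep}(Q,\mathscr{R})$, the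 ring $\mathrm{End}(\rho)$ carries the topology in which the sets $\mathrm{End}(\rho)\cap\prod_{v\in Q_0}I_v(C_v)$, with $I_v\in\mathcal{I}_v$ for all $v\in Q_0$, form a basis of neighborhoods of $0$. *)

(* Defs.v *)
From HB Require Import structures.
From mathcomp Require Import all_boot all_order all_algebra.
From mathcomp Require Import all_classical topology tvs.

Set Implicit Arguments.
Unset Strict Implicit.
Unset Printing Implicit Defensive.

Import GRing.Theory.
Local Open Scope classical_set_scope.
Local Open Scope ring_scope.

(** Rings are [pzRingType]s: noncommutative, and possibly zero, since the
    endomorphism ring of a zero object is the zero ring. *)

Definition invertible (R : pzRingType) (x : R) : Prop :=
  exists y : R, x * y = 1 /\ y * x = 1.

Definition local_ring (R : pzRingType) : Prop :=
  (1 : R) <> 0 /\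
  forall x y : R, ~ invertible x -> ~ invertible y -> ~ invertible (x + y).

(** The ring [eRe], with unity [e]; for [e] idempotent, [x] is in [eRe] if and
    only if [e * x * e = x]. *)
Section Corner.
Variables (R : pzRingType) (e : R) (he : e * e = e).

Definition corner & e * e = e : Type := {x : R | e * x * e == x}.
Local Notation eRe := (corner he).

HB.instance Definition _ := [isSub of eRe for @sval R _].
HB.instance Definition _ := [Choice of eRe by <:].

Definition corner_val (x : eRe) : R := val x.
Definition Corner (x : R) (xP : e * x * e == x) : eRe := exist _ x xP.

Lemma corner_lid (x : eRe) : e * corner_val x = corner_val x.
Proof. by have /eqP xP := svalP x; rewrite /corner_val /= -[in LHS]xP !mulrA he. Qed.

Lemma corner_rid (x : eRe) : corner_val x * e = corner_val x.
Proof. by have /eqP xP := svalP x; rewrite /corner_val /= -[in LHS]xP -!mulrA he mulrA. Qed.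

Fact corner_of_subproof (x : R) : e * (e * x * e) * e == e * x * e.
Proof. by rewrite !mulrA he -!mulrA he. Qed.
Definition corner_of (x : R) : eRe := Corner (corner_of_subproof x).

Fact corner0_subproof : e * 0 * e == 0.
Proof. by rewrite mulr0 mul0r. Qed.
Fact corner1_subproof : e * e * e == e.
Proof. by rewrite !he. Qed.
Fact corner_opp_subproof (x : eRe) :
  e * - corner_val x * e == - corner_val x.
Proof. by rewrite mulrN mulNr corner_lid corner_rid. Qed.
Fact corner_add_subproof (x y : eRe) :
  e * (corner_val x + corner_val y) * e == corner_val x + corner_val y.
Proof. by rewrite mulrDr mulrDl !corner_lid !corner_rid. Qed.
Fact corner_mul_subproof (x y : eRe) :
  e * (corner_val x * corner_val y) * e == corner_val x * corner_val y.
Proof. by rewrite mulrA corner_lid -mulrA corner_rid. Qed.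

Definition corner0 : eRe := Corner corner0_subproof.
Definition corner1 : eRe := Corner corner1_subproof.
Definition corner_opp (x : eRe) : eRe := Corner (corner_opp_subproof x).
Definition corner_add (x y : eRe) : eRe := Corner (corner_add_subproof x y).
Definition corner_mul (x y : eRe) : eRe := Corner (corner_mul_subproof x y).

Fact corner_addA : associative corner_add.
Proof. by move=> x y z; apply: val_inj; rewrite /= addrA. Qed.
Fact corner_addC : commutative corner_add.
Proof. by move=> x y; apply: val_inj; rewrite /= addrC. Qed.
Fact corner_add0 : left_id corner0 corner_add.
Proof. by move=> x; apply: val_inj; rewrite /= add0r. Qed.
Fact corner_addN : left_inverse corner0 corner_opp corner_add.
Proof. by move=> x; apply: val_inj; rewrite /= addNr. Qed.

HB.instance Definition _ :=
  GRing.isZmodule.Build eRe corner_addA corner_addC corner_add0 corner_addN.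

Fact corner_mulA : associative corner_mul.
Proof. by move=> x y z; apply: val_inj; rewrite /= mulrA. Qed.
Fact corner_mul1l : left_id corner1 corner_mul.
Proof. by move=> x; apply: val_inj; rewrite /= corner_lid. Qed.
Fact corner_mul1r : right_id corner1 corner_mul.
Proof. by move=> x; apply: val_inj; rewrite /= corner_rid. Qed.
Fact corner_mulDl : left_distributive corner_mul +%R.
Proof. by move=> x y z; apply: val_inj; rewrite /= mulrDl. Qed.
Fact corner_mulDr : right_distributive corner_mul +%R.
Proof. by move=> x y z; apply: val_inj; rewrite /= mulrDr. Qed.

HB.instance Definition _ := GRing.Zmodule_isPzRing.Build eRe
  corner_mulA corner_mul1l corner_mul1r corner_mulDl corner_mulDr.

End Corner.

(** The empty family ([t = 0]) is allowed, so the zero ring is semiperfect. *)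
Definition semiperfect (R : pzRingType) : Prop :=
  exists (t : nat) (e : 'I_t -> R) (he : forall i, e i * e i = e i),
    [/\ forall i j, i != j -> e i * e j = 0,
        \sum_i e i = 1 &
        forall i, local_ring (corner (he i))].

Definition is_subgroup (V : zmodType) (A : set V) : Prop :=
  A 0 /\ forall x y, A x -> A y -> A (x - y).

Definition is_two_sided_ideal (R : pzRingType) (I : set R) : Prop :=
  is_subgroup I /\ forall r x : R, I x -> I (r * x) /\ I (x * r).

Definition add_span (V : zmodType) (A : set V) : set V :=
  smallest (@is_subgroup V) A.

HB.mixin Record TopologicalZmodule_isTopologicalRing R
    & TopologicalZmodule R & GRing.PzRing R := {
  mul_continuous : continuous (fun x : R * R => x.1 * x.2) }.

#[short(type="topologicalRingType")]
HB.structure Definition TopologicalRing :=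
  {R of TopologicalZmodule R & GRing.PzRing R
      & TopologicalZmodule_isTopologicalRing R}.

HB.mixin Record TopologicalRing_isLTRing R & TopologicalRing R := {
  nbhs0_two_sided_ideal : forall U : set R, nbhs (0 : R) U ->
    exists I : set R, [/\ is_two_sided_ideal I, nbhs (0 : R) I & I `<=` U] }.

#[short(type="ltRingType")]
HB.structure Definition LTRing :=
  {R of TopologicalRing R & TopologicalRing_isLTRing R}.

(** ['M[R]_n] carries the product topology (neighborhoods are entrywise). *)
Definition fitting_property (R : ltRingType) : Prop :=
  hausdorff_space R /\
  forall n : nat, (1 <= n)%N -> forall a : 'M[R]_n,
    exists (e : 'M[R]_n) (he : e * e = e),
      [/\ a = e * a * e + (1 - e) * a * (1 - e),
          invertible (corner_of he a) &
          (fun k : nat => (1 - e) * a ^+ k * (1 - e)) @ \oo --> (0 : 'M[R]_n)].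

Record preaddCat : Type := PreaddCat {
  obj :> Type;
  hom : obj -> obj -> zmodType;
  idm : forall X : obj, hom X X;
  comp : forall X Y Z : obj, hom Y Z -> hom X Y -> hom X Z;
  compA : forall (W X Y Z : obj) (h : hom Y Z) (g : hom X Y) (f : hom W X),
    comp h (comp g f) = comp (comp h g) f;
  comp1f : forall (X Y : obj) (f : hom X Y), comp (idm Y) f = f;
  compf1 : forall (X Y : obj) (f : hom X Y), comp f (idm X) = f;
  compDl : forall (X Y Z : obj) (g g' : hom Y Z) (f : hom X Y),
    comp (g + g') f = comp g f + comp g' f;
  compDr : forall (X Y Z : obj) (g : hom Y Z) (f f' : hom X Y),
    comp g (f + f') = comp g f + comp g f' }.

Arguments hom {p} _ _.
Arguments idm {p} X.
Arguments comp {p X Y Z} _ _.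
Notation "g \oc f" := (comp g f) (at level 40, left associativity).

Lemma comp0f (C : preaddCat) (X Y Z : C) (f : hom X Y) :
  (0 : hom Y Z) \oc f = 0.
Proof. by apply: (addrI (0 \oc f)); rewrite -compDl !addr0. Qed.

Lemma compf0 (C : preaddCat) (X Y Z : C) (g : hom Y Z) :
  g \oc (0 : hom X Y) = 0.
Proof. by apply: (addrI (g \oc 0)); rewrite -compDr !addr0. Qed.

Lemma compNf (C : preaddCat) (X Y Z : C) (g : hom Y Z) (f : hom X Y) :
  (- g) \oc f = - (g \oc f).
Proof. by apply: (addrI (g \oc f)); rewrite -compDl !subrr comp0f. Qed.

Lemma compfN (C : preaddCat) (X Y Z : C) (g : hom Y Z) (f : hom X Y) :
  g \oc (- f) = - (g \oc f).
Proof. by apply: (addrI (g \oc f)); rewrite -compDr !subrr compf0. Qed.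

Definition is_zero_object (C : preaddCat) (Z : C) : Prop :=
  forall X : C, (forall f : hom X Z, f = 0) /\ (forall f : hom Z X, f = 0).

Definition is_biproduct (C : preaddCat) (A B X : C) : Prop :=
  exists (iA : hom A X) (iB : hom B X) (pA : hom X A) (pB : hom X B),
    [/\ pA \oc iA = idm A, pB \oc iB = idm B, pA \oc iB = 0, pB \oc iA = 0 &
        iA \oc pA + iB \oc pB = idm X].

Record addCat : Type := AddCat {
  add_cat :> preaddCat;
  has_zero_object : exists Z : add_cat, is_zero_object Z;
  has_biproducts : forall A B : add_cat, exists X : add_cat,
    is_biproduct A B X }.

Record addFunctor (C D : addCat) : Type := AddFunctor {
  fobj :> C -> D;
  fmap : forall X Y : C, hom X Y -> hom (fobj X) (fobj Y);
  fmap1 : forall X : C, fmap (idm X) = idm (fobj X);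
  fmap_comp : forall (X Y Z : C) (g : hom Y Z) (f : hom X Y),
    fmap (g \oc f) = fmap g \oc fmap f;
  fmapD : forall (X Y : C) (f g : hom X Y), fmap (f + g) = fmap f + fmap g }.

Arguments fmap {C D} a {X Y} _.

Lemma fmap0 (C D : addCat) (F : addFunctor C D) (X Y : C) :
  fmap F (0 : hom X Y) = 0.
Proof. by apply: (addrI (fmap F 0)); rewrite -fmapD !addr0. Qed.

Lemma fmapN (C D : addCat) (F : addFunctor C D) (X Y : C) (f : hom X Y) :
  fmap F (- f) = - fmap F f.
Proof. by apply: (addrI (fmap F f)); rewrite -fmapD !subrr fmap0. Qed.

Definition isomorphic (C : addCat) (X Y : C) : Prop :=
  exists (f : hom X Y) (g : hom Y X), g \oc f = idm X /\ f \oc g = idm Y.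

(** [X] is a direct sum of the finite family [Y]; a zero object when [t = 0]. *)
Definition is_direct_sum (C : addCat) (t : nat) (Y : 'I_t -> C) (X : C) : Prop :=
  exists (i : forall k, hom (Y k) X) (p : forall k, hom X (Y k)),
    [/\ forall k, p k \oc i k = idm (Y k),
        forall k l, k != l -> p k \oc i l = 0 &
        \sum_k (i k \oc p k) = idm X].

Definition indecomposable (C : addCat) (X : C) : Prop :=
  ~ is_zero_object X /\
  forall A B : C, is_biproduct A B X -> is_zero_object A \/ is_zero_object B.

Definition has_krull_schmidt_decomposition (C : addCat) (X : C) : Prop :=
  exists (t : nat) (Y : 'I_t -> C),
    [/\ forall k, indecomposable (Y k), is_direct_sum Y X &
        forall (t' : nat) (Y' : 'I_t' -> C),
          (forall k, indecomposable (Y' k)) -> is_direct_sum Y' X ->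
          t = t' /\ exists s : 'I_t -> 'I_t',
            bijective s /\ forall k, isomorphic (Y k) (Y' (s k))].

Definition pseudo_abelian (C : addCat) : Prop :=
  forall (X : C) (e : hom X X), e \oc e = e ->
    exists (S : C) (i : hom S X) (p : hom X S), i \oc p = e /\ p \oc i = idm S.

Definition krull_schmidt (C : addCat) : Prop :=
  pseudo_abelian C /\ forall X : C, has_krull_schmidt_decomposition X.

Section End.
Variables (C : preaddCat) (X : C).

Definition End : Type := hom X X.
HB.instance Definition _ := GRing.Zmodule.on End.

Definition End_mul (g f : End) : End := comp g f.

Fact End_mulA : associative End_mul.
Proof. by move=> h g f; exact: compA. Qed.
Fact End_mul1l : left_id (idm X : End) End_mul.
Proof. by move=> f; exact: comp1f. Qed.
Fact End_mul1r : right_id (idm X : End) End_mul.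
Proof. by move=> f; exact: compf1. Qed.
Fact End_mulDl : left_distributive End_mul +%R.
Proof. by move=> g g' f; exact: compDl. Qed.
Fact End_mulDr : right_distributive End_mul +%R.
Proof. by move=> g f f'; exact: compDr. Qed.

HB.instance Definition _ := GRing.Zmodule_isPzRing.Build End
  End_mulA End_mul1l End_mul1r End_mulDl End_mulDr.
End End.

Record catIdeal (C : addCat) : Type := CatIdeal {
  ideal_hom :> forall X Y : C, set (hom X Y);
  ideal_subgroup : forall X Y : C, is_subgroup (@ideal_hom X Y);
  ideal_comp : forall (X' X Y Y' : C) (h : hom Y Y') (g : hom X Y)
    (f : hom X' X), @ideal_hom X Y g -> @ideal_hom X' Y' (h \oc g \oc f) }.

Arguments ideal_hom {C} c X Y _.

Record linearTopology (C : addCat) : Type := LinearTopology {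
  lt_ideals : set (catIdeal C);
  lt_nonempty : lt_ideals !=set0;
  lt_directed : forall I J : catIdeal C, lt_ideals I -> lt_ideals J ->
    exists2 K : catIdeal C, lt_ideals K &
      forall X Y : C, K X Y `<=` I X Y `&` J X Y }.

Record ltCat : Type := LTCat {
  lt_cat :> addCat;
  lt_top : linearTopology lt_cat }.

Definition hausdorff_ltCat (C : ltCat) : Prop :=
  forall X Y : C, \bigcap_(I in lt_ideals (lt_top C)) I X Y = [set 0].

(** [End X] with the topology having [{I X X}], [I] in [lt_top C], as a basis
    of neighborhoods of [0]. *)
Section LTEnd.
Variables (C : ltCat) (X : C).

Definition ltEnd : Type := End X.
HB.instance Definition _ := GRing.PzRing.copy ltEnd (End X).

Definition ltEnd_nbhs (f : ltEnd) : set_system ltEnd :=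
  filter_from (lt_ideals (lt_top C))
    (fun I => [set g | I X X ((g : ltEnd) - f)]).
HB.instance Definition _ := hasNbhs.Build ltEnd ltEnd_nbhs.

Lemma ideal0 (I : catIdeal C) : I X X 0.
Proof. by case: (ideal_subgroup I X X). Qed.
Lemma idealB (I : catIdeal C) (f g : hom X X) :
  I X X f -> I X X g -> I X X (f - g).
Proof. by case: (ideal_subgroup I X X) => _; exact. Qed.
Lemma idealN (I : catIdeal C) (f : hom X X) : I X X f -> I X X (- f).
Proof. by move=> If; rewrite -sub0r; apply: idealB => //; exact: ideal0. Qed.
Lemma idealD (I : catIdeal C) (f g : hom X X) :
  I X X f -> I X X g -> I X X (f + g).
Proof. by move=> If Ig; rewrite -[g]opprK; apply/idealB/idealN. Qed.
Lemma idealMl (I : catIdeal C) (h f : ltEnd) : I X X f -> I X X (h * f).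
Proof. by move=> If; have := ideal_comp h (idm X) If; rewrite compf1. Qed.
Lemma idealMr (I : catIdeal C) (h f : ltEnd) : I X X f -> I X X (f * h).
Proof. by move=> If; have := ideal_comp (idm X) h If; rewrite comp1f. Qed.

Fact ltEnd_nbhs_filter (f : ltEnd) : ProperFilter (nbhs f).
Proof.
apply: filter_from_proper; last first.
  by move=> I _; exists f; rewrite /= subrr; exact: ideal0.
apply: filter_from_filter; first exact: lt_nonempty.
move=> I J II JJ; have [K KK sK] := lt_directed II JJ.
by exists K => // g /= /sK.
Qed.

Fact ltEnd_nbhs_singleton (f : ltEnd) (A : set ltEnd) : nbhs f A -> A f.
Proof. by move=> [I _]; apply; rewrite /= subrr; exact: ideal0. Qed.

Fact ltEnd_nbhs_nbhs (f : ltEnd) (A : set ltEnd) :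
  nbhs f A -> nbhs f (nbhs^~ A).
Proof.
move=> [I II sIA]; exists I => // g /= Ig; exists I => // h /= Ih.
by apply: sIA => /=; rewrite -(subrKA g); exact: idealD.
Qed.

HB.instance Definition _ := Nbhs_isNbhsTopological.Build ltEnd
  ltEnd_nbhs_filter ltEnd_nbhs_singleton ltEnd_nbhs_nbhs.

Fact ltEnd_sub_continuous : continuous (fun x : ltEnd * ltEnd => x.1 - x.2).
Proof.
move=> [f g] A [I II sIA].
exists ([set f' | I X X (f' - f)], [set g' | I X X (g' - g)]).
  by split; exists I.
move=> [f' g'] [/= If Ig]; apply: sIA => /=.
have -> : f' - g' - (f - g) = (f' - f) - (g' - g).
  by rewrite !opprB addrACA [in RHS]addrACA; congr (_ + _); rewrite addrC.
exact: idealB.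
Qed.

HB.instance Definition _ :=
  PreTopologicalNmodule_isTopologicalZmodule.Build ltEnd ltEnd_sub_continuous.

Fact ltEnd_mul_continuous : continuous (fun x : ltEnd * ltEnd => x.1 * x.2).
Proof.
move=> [f g] A [I II sIA].
exists ([set f' | I X X (f' - f)], [set g' | I X X (g' - g)]).
  by split; exists I.
move=> [f' g'] [/= If Ig]; apply: sIA => /=.
have -> : f' * g' - f * g = (f' - f) * g' + f * (g' - g).
  by rewrite mulrBl mulrBr subrKA.
by apply: idealD; [exact: idealMr | exact: idealMl].
Qed.

HB.instance Definition _ :=
  TopologicalZmodule_isTopologicalRing.Build ltEnd ltEnd_mul_continuous.

Fact ltEnd_nbhs0_ideal (U : set ltEnd) : nbhs (0 : ltEnd) U ->
  exists I : set ltEnd, [/\ is_two_sided_ideal I, nbhs (0 : ltEnd) I & I `<=` U].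
Proof.
move=> [I II sIU]; exists (I X X); split.
- by split=> [|r x Ix]; [exact: ideal_subgroup | split; [exact: idealMl | exact: idealMr]].
- by exists I => // g /=; rewrite subr0.
- by move=> g Ig; apply: sIU; rewrite /= subr0.
Qed.

HB.instance Definition _ :=
  TopologicalRing_isLTRing.Build ltEnd ltEnd_nbhs0_ideal.
End LTEnd.

Record quiver : Type := Quiver {
  vertex : finType;
  edge : Type;
  src : edge -> vertex;
  tgt : edge -> vertex }.

Record realization (Q : quiver) : Type := Realization {
  vcat : vertex Q -> addCat;
  ecat : edge Q -> addCat;
  srcF : forall a : edge Q, addFunctor (vcat (src a)) (ecat a);
  tgtF : forall a : edge Q, addFunctor (vcat (tgt a)) (ecat a) }.

Arguments vcat {Q} r v.
Arguments ecat {Q} r a.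
Arguments srcF {Q} r a.
Arguments tgtF {Q} r a.

Definition pseudo_abelian_realization (Q : quiver) (R : realization Q) : Prop :=
  forall v : vertex Q, pseudo_abelian (vcat R v).

Lemma dep_choice (I : Type) (T : I -> Type) (P : forall i, T i -> Prop) :
  (forall i, exists x, P i x) -> exists f : forall i, T i, forall i, P i (f i).
Proof. by move=> H; exists (fun i => sval (cid (H i))) => i; exact: svalP. Qed.

Section Rep.
Variables (Q : quiver) (R : realization Q).

Record rep : Type := Rep {
  rep_obj : forall v : vertex Q, vcat R v;
  rep_map : forall a : edge Q,
    hom (srcF R a (rep_obj (src a))) (tgtF R a (rep_obj (tgt a))) }.

Definition is_rep_hom (rho rho' : rep)
    (psi : forall v, hom (rep_obj rho v) (rep_obj rho' v)) : Prop :=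
  forall a : edge Q,
    fmap (tgtF R a) (psi (tgt a)) \oc rep_map rho a =
    rep_map rho' a \oc fmap (srcF R a) (psi (src a)).

Record rep_hom (rho rho' : rep) : Type := RepHom {
  rep_hom_val : forall v, hom (rep_obj rho v) (rep_obj rho' v);
  rep_hom_valP : is_rep_hom rep_hom_val }.

HB.instance Definition _ (rho rho' : rep) := gen_eqMixin (rep_hom rho rho').
HB.instance Definition _ (rho rho' : rep) := gen_choiceMixin (rep_hom rho rho').

Lemma rep_homP (rho rho' : rep) (f g : rep_hom rho rho') :
  (forall v, rep_hom_val f v = rep_hom_val g v) -> f = g.
Proof.
case: f g => [f fP] [g gP] /= fg.
have {}fg : f = g by apply: functional_extensionality_dep.
by rewrite fg in fP *; congr RepHom; exact: Prop_irrelevance.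
Qed.

Section RepHomZmodule.
Variables rho rho' : rep.
Implicit Types f g : rep_hom rho rho'.

Fact rep_hom0_subproof :
  is_rep_hom (fun v => 0 : hom (rep_obj rho v) (rep_obj rho' v)).
Proof. by move=> a; rewrite !fmap0 comp0f compf0. Qed.
Fact rep_hom_opp_subproof f : is_rep_hom (fun v => - rep_hom_val f v).
Proof. by move=> a; rewrite !fmapN compNf compfN rep_hom_valP. Qed.
Fact rep_hom_add_subproof f g :
  is_rep_hom (fun v => rep_hom_val f v + rep_hom_val g v).
Proof. by move=> a; rewrite !fmapD compDl compDr !rep_hom_valP. Qed.

Definition rep_hom0 := RepHom rep_hom0_subproof.
Definition rep_hom_opp f := RepHom (rep_hom_opp_subproof f).
Definition rep_hom_add f g := RepHom (rep_hom_add_subproof f g).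

Fact rep_hom_addA : associative rep_hom_add.
Proof. by move=> f g h; apply: rep_homP => v /=; rewrite addrA. Qed.
Fact rep_hom_addC : commutative rep_hom_add.
Proof. by move=> f g; apply: rep_homP => v /=; rewrite addrC. Qed.
Fact rep_hom_add0 : left_id rep_hom0 rep_hom_add.
Proof. by move=> f; apply: rep_homP => v /=; rewrite add0r. Qed.
Fact rep_hom_addN : left_inverse rep_hom0 rep_hom_opp rep_hom_add.
Proof. by move=> f; apply: rep_homP => v /=; rewrite addNr. Qed.

HB.instance Definition _ := GRing.isZmodule.Build (rep_hom rho rho')
  rep_hom_addA rep_hom_addC rep_hom_add0 rep_hom_addN.
End RepHomZmodule.

Fact rep_idm_subproof (rho : rep) : is_rep_hom (fun v => idm (rep_obj rho v)).
Proof. by move=> a; rewrite !fmap1 comp1f compf1. Qed.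
Definition rep_idm (rho : rep) : rep_hom rho rho :=
  RepHom (rep_idm_subproof rho).

Fact rep_comp_subproof (rho rho' rho'' : rep)
    (g : rep_hom rho' rho'') (f : rep_hom rho rho') :
  is_rep_hom (fun v => rep_hom_val g v \oc rep_hom_val f v).
Proof.
move=> a; rewrite !fmap_comp -compA rep_hom_valP compA rep_hom_valP.
by rewrite compA.
Qed.
Definition rep_comp (rho rho' rho'' : rep)
    (g : rep_hom rho' rho'') (f : rep_hom rho rho') : rep_hom rho rho'' :=
  RepHom (rep_comp_subproof g f).

Definition repPreadd : preaddCat.
Proof.
refine (@PreaddCat rep (fun rho rho' => rep_hom rho rho' : zmodType)
  rep_idm rep_comp _ _ _ _ _) => *; apply: rep_homP => v /=.
- exact: compA.
- exact: comp1f.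
- exact: compf1.
- exact: compDl.
- exact: compDr.
Defined.

Fact rep_has_zero_object : exists Z : repPreadd, is_zero_object Z.
Proof.
have [Z ZP] := dep_choice (fun v => has_zero_object (vcat R v)).
exists (@Rep Z (fun a => 0)) => X; split=> f; apply: rep_homP => v.
  exact: (ZP v _).1.
exact: (ZP v _).2.
Qed.

Fact rep_has_biproducts (A B : repPreadd) :
  exists X : repPreadd, is_biproduct A B X.
Proof.
have [P PP] := dep_choice (fun v => has_biproducts (rep_obj A v) (rep_obj B v)).
have [iA {}PP] := dep_choice PP; have [iB {}PP] := dep_choice PP.
have [pA {}PP] := dep_choice PP; have [pB {}PP] := dep_choice PP.
have eAA v : pA v \oc iA v = idm (rep_obj A v) by case: (PP v).
have eBB v : pB v \oc iB v = idm (rep_obj B v) by case: (PP v).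
have eAB v : pA v \oc iB v = 0 by case: (PP v).
have eBA v : pB v \oc iA v = 0 by case: (PP v).
have e1 v : iA v \oc pA v + iB v \oc pB v = idm (P v) by case: (PP v).
pose X : rep := @Rep P (fun a =>
  fmap (tgtF R a) (iA (tgt a)) \oc rep_map A a \oc
    fmap (srcF R a) (pA (src a)) +
  fmap (tgtF R a) (iB (tgt a)) \oc rep_map B a \oc
    fmap (srcF R a) (pB (src a))).
have iAr : @is_rep_hom A X iA.
  move=> a /=; rewrite compDl -![_ \oc fmap _ _ \oc fmap _ _]compA.
  by rewrite -!fmap_comp eAA eBA fmap0 fmap1 compf0 compf1 addr0.
have iBr : @is_rep_hom B X iB.
  move=> a /=; rewrite compDl -![_ \oc fmap _ _ \oc fmap _ _]compA.
  by rewrite -!fmap_comp eAB eBB fmap0 fmap1 compf0 compf1 add0r.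
have pAr : @is_rep_hom X A pA.
  move=> a /=; rewrite compDr !compA -!fmap_comp eAA eAB fmap0 fmap1.
  by rewrite !comp0f comp1f addr0.
have pBr : @is_rep_hom X B pB.
  move=> a /=; rewrite compDr !compA -!fmap_comp eBA eBB fmap0 fmap1.
  by rewrite !comp0f comp1f add0r.
exists X; exists (RepHom iAr), (RepHom iBr), (RepHom pAr), (RepHom pBr).
split; apply: rep_homP => v /=.
- exact: eAA.
- exact: eBB.
- exact: eAB.
- exact: eBA.
- exact: e1.
Qed.

Definition repCat : addCat := AddCat rep_has_zero_object rep_has_biproducts.

End Rep.

Record ltRealization (Q : quiver) : Type := LTRealization {
  lt_real :> realization Q;
  vtop : forall v : vertex Q, linearTopology (vcat lt_real v) }.

Arguments vtop {Q} l v.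

Section LTRep.
Variables (Q : quiver) (R : ltRealization Q).

Definition vltCat (v : vertex Q) : ltCat := LTCat (vtop R v).

(** The subgroup T_a I'(C') o Hom(S_a C, T_a C') + Hom(S_a C, T_a C') o S_a I(C)
    of Hom(S_a C, T_a C'). *)
Definition edge_subgroup (a : edge Q) (C : vcat R (src a)) (C' : vcat R (tgt a))
    (I : catIdeal (vcat R (src a))) (I' : catIdeal (vcat R (tgt a))) :
    set (hom (srcF R a C) (tgtF R a C')) :=
  [set x + y |
    x in add_span [set fmap (tgtF R a) f \oc h | f in I' C' C' & h in setT] &
    y in add_span [set h \oc fmap (srcF R a) g | h in setT & g in I C C]].

Arguments edge_subgroup {a} C C' I I' _.

Definition hausdorff_realization : Prop :=
  (forall v : vertex Q, hausdorff_ltCat (vltCat v)) /\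
  forall (a : edge Q) (C : vcat R (src a)) (C' : vcat R (tgt a)),
    \bigcap_(I in lt_ideals (vtop R (src a)))
      \bigcap_(I' in lt_ideals (vtop R (tgt a)))
        edge_subgroup C C' I I' = [set 0].

Section RepIdeal.
Variable I : forall v : vertex Q, catIdeal (vcat R v).

Definition rep_ideal_hom (rho rho' : repCat R) : set (hom rho rho') :=
  [set f : rep_hom rho rho' |
    forall v, I v (rep_obj rho v) (rep_obj rho' v) (rep_hom_val f v)].

Fact rep_ideal_subgroup (rho rho' : repCat R) :
  is_subgroup (@rep_ideal_hom rho rho').
Proof.
have IP v := ideal_subgroup (I v) (rep_obj rho v) (rep_obj rho' v).
split=> [v|f g If Ig v]; first exact: (IP v).1.
exact: (IP v).2 (If v) (Ig v).
Qed.

Fact rep_ideal_comp (X' X Y Y' : repCat R) (h : hom Y Y') (g : hom X Y)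
    (f : hom X' X) :
  @rep_ideal_hom X Y g -> @rep_ideal_hom X' Y' (h \oc g \oc f).
Proof. by move=> Ig v; exact: ideal_comp. Qed.

Definition rep_ideal : catIdeal (repCat R) :=
  CatIdeal rep_ideal_subgroup rep_ideal_comp.
End RepIdeal.

Definition rep_ideals : set (catIdeal (repCat R)) :=
  [set rep_ideal I | I in [set I : forall v, catIdeal (vcat R v) |
    forall v, lt_ideals (vtop R v) (I v)]].

Fact rep_ideals_nonempty : rep_ideals !=set0.
Proof.
have [I IP] := dep_choice (fun v => lt_nonempty (vtop R v)).
by exists (rep_ideal I); exists I.
Qed.

Fact rep_ideals_directed (I J : catIdeal (repCat R)) :
  rep_ideals I -> rep_ideals J ->
  exists2 K : catIdeal (repCat R), rep_ideals K &
    forall X Y : repCat R, K X Y `<=` I X Y `&` J X Y.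
Proof.
move=> [I' II' <-] [J' JJ' <-].
have [K KP] : exists K : forall v, catIdeal (vcat R v), forall v,
    lt_ideals (vtop R v) (K v) /\
    forall X Y, K v X Y `<=` I' v X Y `&` J' v X Y.
  apply: (@dep_choice _ _ (fun v L => lt_ideals (vtop R v) L /\
    forall X Y, L X Y `<=` I' v X Y `&` J' v X Y)) => v.
  have [K ? ?] := lt_directed (II' v) (JJ' v).
  by exists K.
exists (rep_ideal K); first by exists K => // v; exact: (KP v).1.
by move=> X Y f Kf; split=> v; have [] := (KP v).2 _ _ _ (Kf v).
Qed.

Definition rep_topology : linearTopology (repCat R) :=
  LinearTopology rep_ideals_nonempty rep_ideals_directed.

Definition repLTCat : ltCat := LTCat rep_topology.

End LTRep.

(* Main.v *)
(** For [rho] in Rep(Q, R), End(rho) is the subring of the product of the rings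
    End(C_v) cut out by the equations [T_a x_t f_a = f_a S_a x_s].

    Fitting's Property descends to it: given a matrix [a] over End(rho), let
    [e_v] be the Fitting idempotent of the component [a_v] and [b_v] the inverse
    of [e_v a_v e_v].  As [e_s = a_s^k b_s^k] for [k >= 1], one has
    [(1 - T e_t) f (S e_s) = T((1 - e_t) a_t^k (1 - e_t)) f (S b_s^k)],
    which lies in every subgroup appearing in the Hausdorff condition at the
    edge, hence is zero; the mirror argument kills [(T e_t) f (1 - S e_s)].  So
    [e], and then [b], is a matrix over End(rho).

    Semiperfectness descends as well: by the exchange argument, a semiperfect
    ring bounds the number of nonzero members of a family of orthogonal
    idempotents with sum 1, so [1] is in End(rho) a sum of primitive orthogonal
    idempotents; and for [e] primitive, Fitting's Property makes every element
    of [e End(rho) e] invertible or topologically nilpotent, so that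
    [e End(rho) e] is local.  The same exchange argument gives the uniqueness
    of Krull-Schmidt decompositions. *)
Require Import Defs.
From HB Require Import structures.
From mathcomp Require Import all_boot all_order all_algebra.
From mathcomp Require Import all_classical topology tvs.

Set Implicit Arguments.
Unset Strict Implicit.
Unset Printing Implicit Defensive.

Import Defs GRing.Theory.
Local Open Scope classical_set_scope.
Local Open Scope ring_scope.

(** * Local rings *)

Section LocalRing.
Variable S : pzRingType.

(** If [x + y] has inverse [u], then [x * u + y * u = 1]; as [u] is a unit, [z] is invertible as
    soon as [z * u] is. *)
Lemma local_ring_add1 : (1 : S) <> 0 ->
  (forall x y : S, x + y = 1 -> invertible x \/ invertible y) -> local_ring S.
Proof.
move=> n0 hadd; split=> // x y nx ny [u [xyu uxy]].
have unit_mulr z : invertible (z * u) -> invertible z.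
  move=> [w [zw wz]]; exists (u * w); split; first by rewrite mulrA.
  have -> : z = z * u * (x + y) by rewrite -mulrA uxy mulr1.
  by rewrite -mulrA (mulrA w) wz mul1r.
by case: (hadd (x * u) (y * u)); rewrite -?mulrDl // => /unit_mulr.
Qed.

Lemma local_ring_sum (J : finType) (x : J -> S) : local_ring S ->
  invertible (\sum_j x j) -> exists j, invertible (x j).
Proof.
move=> [n0 hadd] hx; apply: contrapT => nx; move: hx.
apply: (big_ind (fun y => ~ invertible y)) => [[y [h _]]| |j _ hj].
- by apply: n0; rewrite -h mul0r.
- exact: hadd.
- by apply: nx; exists j.
Qed.
End LocalRing.

(** * Corners, orthogonal idempotents and exchange *)

Section Idempotents.
Variable R : pzRingType.
Implicit Types (e g p x y u : R).

(** Invertibility in [eRe], phrased on elements of [R] to keep computations out of the subtype. *)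
Definition corner_unit e x : Prop :=
  exists u, [/\ e * u * e = u, x * u = e & u * x = e].

Definition local_idem e : Prop := exists he : e * e = e, local_ring (corner he).

Lemma corner_absorb e x : e * e = e -> e * x * e = x -> e * x = x /\ x * e = x.
Proof. by move=> he hx; split; rewrite -hx -?mulrA ?mulrA ?he // -!mulrA he. Qed.

Lemma cornerP e (he : e * e = e) (x : corner he) : e * val x * e = val x.
Proof. by apply/eqP; exact: (svalP x). Qed.

Lemma corner_lift e (he : e * e = e) x : e * x * e = x ->
  exists y : corner he, val y = x.
Proof. by move=> /eqP hx; exists (Corner he hx). Qed.

Lemma invertible_corner e (he : e * e = e) (x : corner he) :
  invertible x <-> corner_unit e (val x).
Proof.
split=> [[y [xy yx]]|[u [hu xu ux]]].
  exists (val y); split; first exact: cornerP.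
    by rewrite -[LHS]/(val (x * y)) xy.
  by rewrite -[LHS]/(val (y * x)) yx.
have [y yu] := corner_lift he hu.
by exists y; split; apply: val_inj; rewrite -?yu in xu ux.
Qed.

Lemma local_idem_idem e : local_idem e -> e * e = e.
Proof. by case. Qed.

Lemma local_idem_neq0 e : local_idem e -> e <> 0.
Proof. by move=> [he [n0 _]] e0; apply: n0; exact: val_inj. Qed.

Lemma local_idem_add e x y : local_idem e ->
  e * x * e = x -> e * y * e = y -> x + y = e ->
  corner_unit e x \/ corner_unit e y.
Proof.
move=> [he [n0 hadd]] /(corner_lift he) [x' <-] /(corner_lift he) [y' <-] xye.
have xy1 : x' + y' = 1 by exact: val_inj.
have [|nx] := pselect (invertible x'); first by move/invertible_corner; left.
have [|ny] := pselect (invertible y'); first by move/invertible_corner; right.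
by case: (hadd _ _ nx ny); rewrite xy1; exists 1; rewrite mulr1.
Qed.

Lemma local_idemI e (he : e * e = e) : e <> 0 ->
  (forall x y, e * x * e = x -> e * y * e = y -> x + y = e ->
    corner_unit e x \/ corner_unit e y) -> local_ring (corner he).
Proof.
move=> n0 hadd; apply: local_ring_add1 => [/(congr1 val) //|x y xy1].
have xye : val x + val y = e by rewrite -[LHS]/(val (x + y)) xy1.
by case: (hadd _ _ (cornerP x) (cornerP y) xye) => /invertible_corner; [left|right].
Qed.

Lemma local_idem_sum e (J : finType) (x : J -> R) : local_idem e ->
  (forall j, e * x j * e = x j) -> \sum_j x j = e ->
  exists j, corner_unit e (x j).
Proof.
move=> [he hl] /(_ _)/(corner_lift he) hx sx.
have [y yx] := choice hx.
have [|j] := local_ring_sum (x := y) hl; last first.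
  by rewrite invertible_corner yx; exists j.
suff -> : \sum_j y j = 1 by exists 1; rewrite mulr1.
apply: val_inj; rewrite /= -[RHS]sx.
transitivity (\sum_j val (y j)); last by apply: eq_bigr => j _; exact: yx.
by elim/big_ind2 : _ => // _ u _ v <- <-.
Qed.

Definition ortho_idem (J : finType) (g : J -> R) : Prop :=
  forall i j, g i * g j = if i == j then g i else 0.

(** For idempotents this is isomorphism of the right modules [eR] and [gR], by left multiplication
    with [a] and [b]. *)
Definition idem_equiv e g : Prop :=
  exists a b, [/\ e * a * g = a, g * b * e = b, a * b = e & b * a = g].

Lemma ortho_idemE (J : finType) (g : J -> R) :
  (forall i, g i * g i = g i) -> (forall i j, i != j -> g i * g j = 0) ->
  ortho_idem g.
Proof. by move=> h1 h2 i j; case: eqVneq => [->|/h2]. Qed.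

Section Family.
Variables (J : finType) (g : J -> R) (og : ortho_idem g).

Lemma ortho_id j : g j * g j = g j.
Proof. by rewrite og eqxx. Qed.

Lemma ortho_mul_sum j : g j * \sum_i g i = g j.
Proof.
rewrite big_distrr (bigD1 j) //= ortho_id big1 ?addr0 // => i ij.
by rewrite og eq_sym (negPf ij).
Qed.

Lemma ortho_sum_mul j : (\sum_i g i) * g j = g j.
Proof.
rewrite big_distrl (bigD1 j) //= ortho_id big1 ?addr0 // => i ij.
by rewrite og (negPf ij).
Qed.

Lemma ortho_sum_idem : (\sum_i g i) * (\sum_i g i) = \sum_i g i.
Proof. by rewrite big_distrl /=; apply: eq_bigr => j _; exact: ortho_mul_sum. Qed.

(** Splitting off [p] keeps the index type, at the price of possibly zero members; [fsupp] below
    counts the nonzero ones. *)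
Definition shrink j p i := if i == j then g j - p else g i.

Lemma ortho_shrink j p : p * p = p -> g j * p = p -> p * g j = p ->
  ortho_idem (shrink j p).
Proof.
move=> pp gp pg i i'; rewrite /shrink.
have p0l k : k != j -> g k * p = 0.
  by move=> kj; rewrite -gp mulrA og (negPf kj) mul0r.
have p0r k : k != j -> p * g k = 0.
  by move=> kj; rewrite -pg -mulrA og eq_sym (negPf kj) mulr0.
have [ij|ij] := eqVneq i j; have [i'j|i'j] := eqVneq i' j.
- by rewrite ij i'j eqxx mulrBl !mulrBr ortho_id pp gp pg subrr subr0.
- by rewrite ij eq_sym (negPf i'j) mulrBl og eq_sym (negPf i'j) p0r // subr0.
- by rewrite i'j mulrBr og (negPf ij) p0l // subr0.
- exact: og.
Qed.

Lemma sum_shrink j p : \sum_i shrink j p i = \sum_i g i - p.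
Proof.
rewrite (bigD1 j) //= [in RHS](bigD1 j) //= /shrink eqxx addrAC.
by congr (_ + _ - _); apply: eq_bigr => i /negPf ->.
Qed.

End Family.

Section Exchange.
Variables (J : finType) (g : J -> R) (og : ortho_idem g).

(* Given an isomorphism between [E] and [\sum_j g j], the [e]-block of one of
   the [g j] is invertible; [p] is the copy of [e] below that [g j], and the
   isomorphism of the complements is the Schur complement of that block. *)
Lemma exchange E e : local_idem e -> E * E = E -> E * e = e -> e * E = e ->
  idem_equiv E (\sum_j g j) ->
  exists j p, [/\ p * p = p, g j * p = p, p * g j = p, idem_equiv e p &
                  idem_equiv (E - e) (\sum_j g j - p)].
Proof.
set G := \sum_j g j => le EE Ee eE [a [b [ha hb ab ba]]].
have ee := local_idem_idem le.
have GG : G * G = G := ortho_sum_idem og.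
have aG : a * G = a by rewrite -ha -!mulrA GG.
have Ea : E * a = a by rewrite -ha !mulrA EE.
have bE : b * E = b by rewrite -hb -!mulrA EE.
have Gb : G * b = b by rewrite -hb !mulrA GG.
(* These elements sum to [e * a * b * e = e], and the unity of a local ring is not a sum of
   non-units. *)
have [j [u [hu cu uc]]] : exists j, corner_unit e (e * a * g j * b * e).
  apply: local_idem_sum => // [j|]; first by rewrite !mulrA ee -!mulrA ee.
  by rewrite -!mulr_suml -mulr_sumr -/G -!mulrA (mulrA G) Gb (mulrA a) ab Ee ee.
have [eu ue] := corner_absorb ee hu.
(* The factor [u] normalizes [y] so that [x * y = e]; then [y * x] is an idempotent equivalent to
   [e]. *)
pose x := e * a * g j; pose y := g j * b * e * u.
have gj : g j * g j = g j by rewrite og eqxx.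
have Ggj : G * g j = g j := ortho_sum_mul og j.
have gjG : g j * G = g j := ortho_mul_sum og j.
have xg : x * g j = x by rewrite /x -mulrA gj.
have gy : g j * y = y by rewrite /y !mulrA gj.
have ex : e * x = x by rewrite /x !mulrA ee.
have ye : y * e = y by rewrite /y -mulrA ue.
have xy : x * y = e by rewrite /x /y !mulrA -(mulrA _ (g j) (g j)) gj.
have eay : e * a * y = e by rewrite -[RHS]xy /x -!mulrA gy.
clearbody x y; pose p := y * x.
have pp : p * p = p by rewrite /p mulrA -(mulrA y) xy ye.
have gp : g j * p = p by rewrite /p mulrA gy.
have pg : p * g j = p by rewrite /p -mulrA xg.
have Gp : G * p = p by rewrite -gp mulrA Ggj.
have pG : p * G = p by rewrite -pg -mulrA gjG.
have Gy : G * y = y by rewrite -gy mulrA Ggj.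
have py : p * y = y by rewrite /p -mulrA xy ye.
have yE : y * E = y by rewrite -ye -mulrA eE.
exists j, p; split=> //.
  exists x, y; split=> //; first by rewrite ex /p mulrA xy ex.
  by rewrite py ye.
(* The complements get opaque names, so that rewriting treats them as atoms. *)
have [E' dE] : exists E', E' = E - e by exists (E - e).
have [G' dG] : exists G', G' = G - p by exists (G - p).
rewrite -dE -dG.
have E'E' : E' * E' = E' by rewrite dE mulrBl !mulrBr EE Ee eE ee subrr subr0.
have G'G' : G' * G' = G' by rewrite dG mulrBl !mulrBr GG Gp pG pp subrr subr0.
have G'y : G' * y = 0 by rewrite dG mulrBl Gy py subrr.
have yE' : y * E' = 0 by rewrite dE mulrBr yE ye subrr.
(* The correction [a * y * a] makes [s] vanish on [p]. The Schur complement is [E' * s * G'], and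
   its inverse is the matching block of [b]. *)
pose s := a - a * y * a.
have yap : y * a * p = p.
  by rewrite /p -{1}ye !mulrA -(mulrA y e a) -(mulrA y (e * a) y) eay ye.
have sG' : s * G' = s.
  have sp : s * p = 0 by rewrite /s mulrBl -!mulrA (mulrA y) yap subrr.
  by rewrite dG mulrBr sp subr0 /s mulrBl -!mulrA aG.
have E'E : E' * E = E' by rewrite dE mulrBl EE eE.
have G'G : G' * G = G' by rewrite dG mulrBl GG pG.
exists (E' * s * G'), (G' * b * E'); split.
- by rewrite !mulrA E'E' -!mulrA G'G'.
- by rewrite !mulrA G'G' -!mulrA E'E'.
- have sb : s * b = E - a * y by rewrite /s mulrBl ab -!mulrA ab yE.
  rewrite -(mulrA E' s) sG' !mulrA -(mulrA E' s) sG' -(mulrA E') sb.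
  by rewrite mulrBr mulrBl E'E E'E' mulrA -!mulrA yE' !mulr0 subr0.
- have bs : b * E' * s = G - y * a.
    rewrite dE (mulrBr b) bE /s mulrBl !mulrBr ba !mulrA ba Gy.
    rewrite -(mulrA b e a) -(mulrA b (e * a) y) eay.
    by rewrite mulrA subrr subr0.
  rewrite !mulrA -(mulrA _ E' E') E'E' -(mulrA G' b) -(mulrA G' (b * E')) bs.
  by rewrite mulrBr mulrBl G'G G'G' mulrA G'y !mul0r subr0.
Qed.
End Exchange.

End Idempotents.

(** * Algebra of a Fitting decomposition *)

Section FittingSplit.
Variable S : pzRingType.

(** The block decomposition makes [a] commute with [e], so the inverse in the corner satisfies
    [a * b = e] without cutting [a] down. Such equations can be checked vertex by vertex. *)
Lemma fitting_split (a e : S) (he : e * e = e) :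
  a = e * a * e + (1 - e) * a * (1 - e) -> invertible (corner_of he a) ->
  exists b, [/\ e * b * e = b, a * b = e, b * a = e & e * a = a * e].
Proof.
move=> aE /invertible_corner [b [hb ab ba]]; rewrite /= in ab ba.
have en : e * (1 - e) = 0 by rewrite mulrBr mulr1 he subrr.
have ne : (1 - e) * e = 0 by rewrite mulrBl mul1r he subrr.
have ea : e * a = e * a * e.
  by rewrite {1}aE mulrDr !mulrA he en !mul0r addr0.
have ae : a * e = e * a * e.
  by rewrite {1}aE mulrDl -!mulrA he ne !mulr0 addr0.
have [eb be] := corner_absorb he hb.
exists b; split=> //; last by rewrite ea ae.
  by rewrite -eb mulrA ae.
by rewrite -be -mulrA ea.
Qed.

(** The powers telescope because [b] commutes with [e]; the extra factor [e] covers [k = 0]. *)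
Lemma fitting_split_pow (a e b : S) k : e * e = e -> e * b * e = b ->
  a * b = e -> b * a = e ->
  a ^+ k * (b ^+ k * e) = e /\ (e * b ^+ k) * a ^+ k = e.
Proof.
move=> ee hb ab ba; have [eb be] := corner_absorb ee hb.
have ce : GRing.comm e b by rewrite /GRing.comm eb be.
have cb m : e * b ^+ m = b ^+ m * e by exact: commrX.
elim: k => [|k [IH1 IH2]]; first by rewrite !expr0 !mul1r !mulr1.
split.
  by rewrite exprSr exprS -!mulrA (mulrA a) ab (mulrA e) cb -(mulrA _ e e) ee.
rewrite (exprSr b) (exprS a) !mulrA -(mulrA _ b a) ba cb -(mulrA _ e e) ee.
by rewrite -cb.
Qed.

Lemma compl_idem_pow (a e : S) k : e * e = e -> e * a = a * e ->
  (1 - e) * a ^+ k * (1 - e) = (1 - e) * a ^+ k /\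
  (1 - e) * a ^+ k * (1 - e) = a ^+ k * (1 - e).
Proof.
move=> ee ea; have ca : GRing.comm (1 - e) (a ^+ k).
  by apply: commrX; rewrite /GRing.comm mulrBl mulrBr mul1r mulr1 ea.
have ne : (1 - e) * (1 - e) = 1 - e.
  by rewrite mulrBl mul1r mulrBr mulr1 ee subrr subr0.
by split; [rewrite -mulrA -ca mulrA ne | rewrite ca -mulrA ne].
Qed.
(** Converse of [fitting_split], for use once [e] and [b] have been lifted to End(rho). *)
Lemma fitting_join (a e b : S) (he : e * e = e) : e * b * e = b ->
  a * b = e -> b * a = e -> e * a = a * e ->
  a = e * a * e + (1 - e) * a * (1 - e) /\ invertible (corner_of he a).
Proof.
move=> hb ab ba ea; have [eb be] := corner_absorb he hb.
have eae : e * a * e = a * e by rewrite ea -mulrA he.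
split.
  have [_] := compl_idem_pow 1 he ea; rewrite expr1 => ->.
  by rewrite eae mulrBr mulr1 addrC subrK.
apply/invertible_corner; exists b; split=> //=.
  by rewrite -mulrA eb -mulrA ab he.
by rewrite !mulrA be ba he.
Qed.

End FittingSplit.

(** * Comparison of decompositions and primitive idempotents *)

Section Azumaya.
Variable R : pzRingType.
Implicit Types (e g p x y u : R).

Lemma idem_equiv_refl e : e * e = e -> idem_equiv e e.
Proof. by move=> ee; exists e, e; rewrite !ee. Qed.

Lemma idem_equiv_neq0 e p : e <> 0 -> idem_equiv e p -> p <> 0.
Proof.
move=> n0 [a [b [ha _ ab _]]] p0; apply: n0.
by rewrite -ab -ha p0 mulr0 mul0r.
Qed.

Definition fsupp (J : finType) (g : J -> R) : {set J} := [set j | g j != 0].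

(** Zero counts as primitive, so that a family keeps the property when a member is replaced by
    zero. *)
Definition primitive_idem g : Prop :=
  forall p, p * p = p -> g * p = p -> p * g = p -> p = 0 \/ p = g.

Lemma fsupp_shrink (J : finType) (g : J -> R) j :
  fsupp (shrink g j (g j)) = fsupp g :\ j.
Proof.
apply/setP => i; rewrite !inE /shrink.
by case: (eqVneq i j) => [->|//]; rewrite subrr eqxx.
Qed.

Lemma fsupp_sub_shrink (J : finType) (g : J -> R) j p :
  (fsupp g \subset j |: fsupp (shrink g j p))%SET.
Proof.
by apply/fintype.subsetP => i; rewrite !inE /shrink; case: (eqVneq i j).
Qed.

Lemma ortho_sum_eq0 (J : finType) (g : J -> R) : ortho_idem g -> \sum_j g j = 0 ->
  forall j, g j = 0.
Proof. by move=> og g0 j; rewrite -(ortho_mul_sum og) g0 mulr0. Qed.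

Lemma idem_equiv0 g : idem_equiv 0 g -> g = 0.
Proof. by move=> [a [b [_ hb _ <-]]]; rewrite -hb mulr0 mul0r. Qed.

(** One round of [exchange] in a form that iterates: [e k] leaves the first family, its copy [p]
    leaves the second. *)
Lemma exchange_family (K J : finType) (e : K -> R) (g : J -> R) k :
  ortho_idem e -> ortho_idem g -> local_idem (e k) ->
  idem_equiv (\sum_k e k) (\sum_j g j) ->
  exists j p, [/\ p * p = p, g j * p = p /\ p * g j = p, idem_equiv (e k) p,
    ortho_idem (shrink e k (e k)) /\ ortho_idem (shrink g j p) &
    idem_equiv (\sum_i shrink e k (e k) i) (\sum_i shrink g j p i)].
Proof.
move=> oe og lk /exchange -/(_ og _ lk) [].
- exact: ortho_sum_idem.
- exact: ortho_sum_mul.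
- exact: ortho_mul_sum.
move=> j [p [pp gp pg ep eg]]; exists j, p; rewrite !sum_shrink.
by split=> //; split; apply: ortho_shrink => //; rewrite oe eqxx.
Qed.

Lemma shrink_local (K : finType) (e : K -> R) k :
  (forall i, e i <> 0 -> local_idem (e i)) ->
  forall i, shrink e k (e k) i <> 0 -> local_idem (shrink e k (e k) i).
Proof.
move=> le i; rewrite /shrink; case: (eqVneq i k) => [_|_]; last exact: le.
by rewrite subrr.
Qed.

(** Each round removes one nonzero member of [e] and can turn at most one member of [g], namely
    [g j], into zero. *)
Lemma card_fsupp_local (K J : finType) (e : K -> R) (g : J -> R) :
  ortho_idem e -> ortho_idem g -> (forall k, e k <> 0 -> local_idem (e k)) ->
  idem_equiv (\sum_k e k) (\sum_j g j) -> (#|fsupp g| <= #|fsupp e|)%N.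
Proof.
elim: {e}_.+1 {-2}e (ltnSn #|fsupp e|) g => // n IH e en g oe og le eg.
have [e0|[k ek]] : (forall k, e k = 0) \/ (exists k, e k <> 0).
  have [|/existsNP] := pselect (forall k, e k = 0); first by left.
  by right.
- rewrite big1 // in eg; have /ortho_sum_eq0 -/(_ og) g0 := idem_equiv0 eg.
  rewrite (_ : fsupp g = finset.set0) ?cards0 //.
  by apply/setP => j; rewrite !inE g0 eqxx.
have [j [p [_ _ _ [oe' og'] eg']]] := exchange_family oe og (le k ek) eg.
have ke : k \in fsupp e by rewrite inE; apply/eqP.
have ce : #|fsupp e| = #|fsupp (shrink e k (e k))|.+1.
  by rewrite fsupp_shrink (cardsD1 k (fsupp e)) ke.
rewrite ce; apply: leq_trans (subset_leq_card (fsupp_sub_shrink g j p)) _.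
rewrite cardsU1 -add1n leq_add ?leq_b1 //; apply: IH => //.
- by rewrite -ltnS -ce.
- exact: shrink_local.
Qed.

(** By primitivity the copy of [e k] below [g j] is all of [g j], so each round pairs [k] with [j]
    and removes both. [j0] is the value of [s] once [e] is exhausted. *)
Lemma azumaya (K J : finType) (e : K -> R) (g : J -> R) (j0 : J) :
  ortho_idem e -> ortho_idem g -> (forall k, e k <> 0 -> local_idem (e k)) ->
  (forall j, primitive_idem (g j)) ->
  idem_equiv (\sum_k e k) (\sum_j g j) ->
  exists s : K -> J,
    [/\ forall k, e k <> 0 -> g (s k) <> 0 /\ idem_equiv (e k) (g (s k)),
        {in fsupp e &, injective s} &
        forall j, g j <> 0 -> exists2 k, e k <> 0 & s k = j].
Proof.
elim: {e}_.+1 {-2}e (ltnSn #|fsupp e|) g => // n IH e en g oe og le pg eg.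
have [e0|[k ek]] : (forall k, e k = 0) \/ (exists k, e k <> 0).
  have [|/existsNP] := pselect (forall k, e k = 0); first by left.
  by right.
- rewrite big1 // in eg; have /ortho_sum_eq0 -/(_ og) g0 := idem_equiv0 eg.
  exists (fun=> j0); split=> [k /(_ (e0 k)) //|k i|j /(_ (g0 j)) //].
  by rewrite inE e0 eqxx.
have [j [p [pp [gp pgj] ep [oe' og'] eg']]] := exchange_family oe og (le k ek) eg.
have pE : p = g j.
  by case: (pg j p) => // p0; case: (idem_equiv_neq0 ek ep).
rewrite {p}pE in pp gp pgj ep og' eg'.
have gj : g j <> 0 := idem_equiv_neq0 ek ep.
have ce : #|fsupp e| = #|fsupp (shrink e k (e k))|.+1.
  by rewrite fsupp_shrink (cardsD1 k (fsupp e)) inE; case: eqP ek.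
case: (IH (shrink e k (e k)) _ (shrink g j (g j))) => //.
- by rewrite -ltnS -ce.
- exact: shrink_local.
- move=> i; rewrite /shrink; case: (eqVneq i j) => [_|_]; last exact: pg.
  by rewrite subrr => q _ <- _; left; rewrite mul0r.
move=> s [es si ss]; exists (fun i => if i == k then j else s i); split.
- move=> i ei; case: (eqVneq i k) => [->//|ik].
  have := es i; rewrite /shrink (negPf ik) => /(_ ei).
  by case: (eqVneq (s i) j) => [_|//]; rewrite subrr => -[].
(* The later rounds match nonzero members, and the member at [j] has become zero. *)
- have sj i : i != k -> e i != 0 -> s i != j.
    move=> ik /eqP ei; have [] := es i; rewrite /shrink (negPf ik) //.
    by case: (eqVneq (s i) j) => // _; rewrite subrr.
  move=> i i'; rewrite !inE => ei ei'.
  case: (eqVneq i k) => [->|ik]; case: (eqVneq i' k) => [->//|ik'].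
  + by move/esym/eqP; rewrite (negPf (sj _ _ _)).
  + by move/eqP; rewrite (negPf (sj _ _ _)).
  by apply: si; rewrite fsupp_shrink !inE ?ik ?ik'.
- move=> i gi; have [->|ij] := eqVneq i j; first by exists k; rewrite ?eqxx.
  have [|i' ei' si'] := ss i; first by rewrite /shrink (negPf ij).
  move: ei'; rewrite /shrink; case: (eqVneq i' k) => [_|ik ei'].
    by rewrite subrr.
  by exists i'; rewrite ?(negPf ik).
Qed.

(** In a decomposition of [1] with the largest number of nonzero members, a proper splitting of one
    member would give a longer decomposition. *)
Lemma primitive_decomposition (B : nat) :
  (forall n (g : 'I_n -> R), ortho_idem g -> (forall i, g i <> 0) ->
    \sum_i g i = 1 -> (n <= B)%N) ->
  exists n (g : 'I_n -> R), [/\ ortho_idem g, \sum_i g i = 1,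
    forall i, g i <> 0 & forall i, primitive_idem (g i)].
Proof.
move=> bnd.
pose P n := `[< exists g : 'I_n -> R,
  [/\ ortho_idem g, \sum_i g i = 1 & forall i, g i <> 0] >].
have exP : exists n, P n.
  have [R0|R1] := eqVneq (1 : R) 0.
    exists 0%N; apply/asboolP; exists (fun=> 0); split=> [[]//||[]//].
    by rewrite big_ord0 R0.
  exists 1%N; apply/asboolP; exists (fun=> 1); split=> [i j||_]; last exact/eqP.
    by rewrite !ord1 eqxx mulr1.
  by rewrite big_ord1.
have ubP n : P n -> (n <= B)%N.
  by move=> /asboolP [g [og g1 g0]]; exact: bnd og g0 g1.
case: (ex_maxnP exP ubP) => n /asboolP [g [og g1 g0]] nmax.
exists n, g; split=> // i p pp gp pg; apply: contrapT => /not_orP [p0 pgi].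
suff /nmax : P n.+1 by rewrite ltnn.
apply/asboolP.
(* The longer family: [p] in position 0, then the old family with [g i - p] in place of [g i]. *)
exists (fun k => if unlift ord0 k is Some j then shrink g i p j else p).
have pd j : p * shrink g i p j = 0.
  rewrite /shrink; have [_|ij] := eqVneq j i; first by rewrite mulrBr pg pp subrr.
  by rewrite -pg -mulrA og eq_sym (negPf ij) mulr0.
have dp j : shrink g i p j * p = 0.
  rewrite /shrink; have [_|ij] := eqVneq j i; first by rewrite mulrBl gp pp subrr.
  by rewrite -gp mulrA og (negPf ij) mul0r.
split.
- move=> k l; case: (unliftP ord0 k) => [k'|] ->; case: (unliftP ord0 l) => [l'|] ->.
  + by rewrite (ortho_shrink og) // (inj_eq lift_inj).
  + by rewrite dp eq_sym (negPf (neq_lift _ _)).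
  + by rewrite pd (negPf (neq_lift _ _)).
  + by rewrite eqxx.
- rewrite big_ord_recl unlift_none; under eq_bigr do rewrite liftK.
  by rewrite sum_shrink g1 addrC addrNK.
- move=> k; case: (unliftP ord0 k) => [k'|] _ //; rewrite /shrink.
  by case: eqVneq => _; [move/subr0_eq/esym | exact: g0].
Qed.

End Azumaya.

(** * Semiperfect rings and the length of decompositions *)

Lemma semiperfectP (R : pzRingType) : semiperfect R <->
  exists t (e : 'I_t -> R),
    [/\ ortho_idem e, \sum_i e i = 1 & forall i, local_idem (e i)].
Proof.
split=> [[t [e [he [oe e1 le]]]]|[t [e [oe e1 le]]]]; exists t, e.
  split=> // [|i]; last by exists (he i); exact: le.
  by apply: ortho_idemE.
exists (fun i => local_idem_idem (le i)); split=> // [i j ij|i].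
  by rewrite oe (negPf ij).
have [he] := le i.
by rewrite (_ : local_idem_idem (le i) = he) //; exact: Prop_irrelevance.
Qed.

(** The bound is the length of one decomposition of [1] into local idempotents, compared with [g] by
    [card_fsupp_local]. *)
Lemma semiperfect_bound (R : pzRingType) : semiperfect R ->
  exists t : nat, forall (J : finType) (g : J -> R), ortho_idem g ->
    \sum_j g j = 1 -> (#|fsupp g| <= t)%N.
Proof.
move=> /semiperfectP [t [e [oe e1 le]]]; exists t => J g og g1.
rewrite -[leqRHS]card_ord; apply: leq_trans (max_card (mem (fsupp e))).
apply: card_fsupp_local => //; rewrite e1 g1.
by apply: idem_equiv_refl; rewrite mulr1.
Qed.

(* Semiperfectness of the rings [W v] bounds the number of summands in a
   decomposition of [1] into orthogonal idempotents of [R]. *)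
Lemma primitive_decomposition_sub (R : pzRingType) (V : finType)
    (W : V -> pzRingType) (phi : forall v, {rmorphism R -> W v}) :
  (forall x, (forall v, phi v x = 0) -> x = 0) ->
  (forall v, semiperfect (W v)) ->
  exists n (g : 'I_n -> R), [/\ ortho_idem g, \sum_i g i = 1,
    forall i, g i <> 0 & forall i, primitive_idem (g i)].
Proof.
move=> phi_inj spW.
have [t tP] := choice (fun v => semiperfect_bound (spW v)).
apply: (@primitive_decomposition _ (\sum_v t v)) => n g og g0 g1.
rewrite -[leqLHS]card_ord -cardsT.
(* A single [phi v] may kill [g i], but by joint injectivity not all of them do. *)
have sub : ([set: 'I_n] \subset \bigcup_v fsupp (fun i => phi v (g i)))%SET.
  apply/fintype.subsetP => i _; apply: contrapT => /negP ni; apply: (g0 i).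
  apply: phi_inj => v; apply/eqP; apply: contrapT => /negP pi.
  by move/negP: ni; apply; apply/finset.bigcupP; exists v => //; rewrite inE.
apply: leq_trans (subset_leq_card sub) _.
apply: leq_trans (_ : \sum_v #|fsupp (fun i => phi v (g i))| <= _)%N; last first.
  apply: leq_sum => v _; apply: tP => [i j|].
    by rewrite -rmorphM og; case: ifP => // _; rewrite rmorph0.
  by rewrite -rmorph_sum g1 rmorph1.
elim/big_ind2 : _ => // [|m A m' A' hA hA']; first by rewrite cards0.
by apply: leq_trans (leq_card_setU _ _) _; exact: leq_add.
Qed.

(** * Fitting's property and locality of primitive corners *)

Section Fitting.
Variable R : ltRingType.

Lemma mx_cvg0 n (M : nat -> 'M[R]_n) :
  M @ \oo --> (0 : 'M[R]_n) <->
  forall U : set R, nbhs (0 : R) U ->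
    exists N, forall k, (N <= k)%N -> forall i j, U (M k i j).
Proof.
split=> [cM U U0|hM A [P P0 sPA]].
  have [|N _ hN] := cM [set A | forall i j, U (A i j)].
    by exists (fun _ _ => U) => // i j; rewrite mxE.
  by exists N => k Nk; exact: hN.
have hP (ij : 'I_n * 'I_n) : exists N,
    forall k, (N <= k)%N -> P ij.1 ij.2 (M k ij.1 ij.2).
  have [|N hN] := hM (P ij.1 ij.2); first by have := P0 ij.1 ij.2; rewrite mxE.
  by exists N => k /hN.
have [N hN] := choice hP.
exists (\max_ij N ij)%N => // k /= Nk; apply: sPA => i j.
by apply: (hN (i, j)); apply: leq_trans Nk; exact: leq_bigmax.
Qed.

Lemma hausdorff_eq0 (x : R) : hausdorff_space R ->
  (forall U : set R, nbhs (0 : R) U -> U x) -> x = 0.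
Proof.
move=> hR hx; apply: esym; apply: hR => A B A0 Bx.
by exists x; split; [exact: hx | exact: nbhs_singleton].
Qed.

Lemma ideal_sum (I : set R) (J : finType) (x : J -> R) : is_two_sided_ideal I ->
  (forall j, I (x j)) -> I (\sum_j x j).
Proof.
move=> [[I0 IB] _] hx; apply: (big_ind I) => // a b Ia Ib.
by rewrite -[b]opprK -[- b]add0r; apply: (IB) => //; exact: IB.
Qed.

(** The case of matrices of size one, read on the single entry. *)
Lemma fitting_elem (x : R) : fitting_property R ->
  exists f u, [/\ f * f = f, f * u * f = u, x * u = f, u * x = f &
    forall U : set R, nbhs (0 : R) U ->
      exists N, forall k, (N <= k)%N -> U ((1 - f) * x ^+ k * (1 - f))].
Proof.
move=> [_ /(_ 1%N isT x%:M) [F [FF [xF uF /mx_cvg0 cF]]]].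
have [G [hG FG GF _]] := fitting_split xF uF.
have M00 (A B : 'M[R]_1) : (A * B) ord0 ord0 = A ord0 ord0 * B ord0 ord0.
  by rewrite mxE big_ord1.
have x00 : (x%:M : 'M[R]_1) ord0 ord0 = x by rewrite mxE eqxx.
have X00 (A : 'M[R]_1) k : (A ^+ k) ord0 ord0 = A ord0 ord0 ^+ k.
  by elim: k => [|k IH]; rewrite ?mxE ?eqxx // !exprS M00 IH.
exists (F ord0 ord0), (G ord0 ord0); split.
- by rewrite -M00 FF.
- by rewrite -!M00 hG.
- by rewrite -[x]x00 -M00 FG.
- by rewrite -[x]x00 -M00 GF.
move=> U /cF [N hN]; exists N => k /hN /(_ ord0 ord0).
by rewrite !M00 X00 x00 !mxE eqxx.
Qed.

Lemma primitive_local (e : R) : fitting_property R -> e * e = e -> e <> 0 ->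
  primitive_idem e -> local_idem e.
Proof.
move=> fR ee e0 pe; exists ee; apply: local_idemI => // x y hx hy xye.
(* The Fitting idempotent of [z] lies below [e], hence is [e] or [0]: [z] is a unit of the corner or
   topologically nilpotent. *)
have alt z : e * z * e = z -> corner_unit e z \/
    forall U : set R, nbhs (0 : R) U -> exists N, forall k, (N <= k)%N -> U (z ^+ k).
  move=> hz; have [ez ze] := corner_absorb ee hz.
  have [f [u [ff fu zu uz cf]]] := fitting_elem z fR.
  have ef : e * f = f by rewrite -zu mulrA ez.
  have fe : f * e = f by rewrite -uz -mulrA ze.
  case: (pe f ff ef fe) => fE; rewrite fE in fu zu uz cf; last by left; exists u.
  right=> U /cf [N hN]; exists N => k /hN.
  by rewrite subr0 mul1r mulr1.
case: (alt x hx) => [|nx]; first by left.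
case: (alt y hy) => [|ny]; first by right.
exfalso; apply: e0; apply: hausdorff_eq0 fR.1 _ => U /nbhs0_two_sided_ideal.
move=> [I [II I0 sIU]]; apply: sIU.
have [m hm] := nx I I0; have [n hn] := ny I I0.
(* The exponent must be positive, since [e ^+ 0] is [1]. *)
have -> : e = e ^+ (m + n).+1.
  by elim: (m + n)%N => [|k IH]; rewrite ?expr1 // exprS -IH ee.
have [ex xe] := corner_absorb ee hx.
have xy : GRing.comm x y.
  by rewrite /GRing.comm -[y](addKr x) xye mulrDr mulrDl mulrN mulNr ex xe.
(* Every binomial term contains [x] to a power at least [m] or [y] to a power at least [n]. So [e]
   lies in every neighborhood of 0. *)
rewrite -xye exprDn_comm //; apply: ideal_sum => // i.
case: (II) => [_ IM].
have In (z : R) k : I z -> I (z *+ k).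
  by move=> Iz; rewrite -mulr_natl; exact: (IM _ _ Iz).1.
apply: In; case: (leqP n i) => [ni|ni]; first exact: (IM _ _ (hn _ ni)).1.
apply: (IM _ _ (hm _ _)).2.
by rewrite leq_subRL ?leq_ord // addnC leqW // leq_add2l ltnW.
Qed.

End Fitting.

(** * Krull-Schmidt decompositions in pseudo-abelian categories *)

Section KrullSchmidt.
Variable C : addCat.
Implicit Types X Y A B : C.

Lemma zero_objectP A : is_zero_object A <-> idm A = 0.
Proof.
split=> [/(_ A) [h _]|A0 Y]; first exact: h.
by split=> f; [rewrite -[f]comp1f A0 comp0f|rewrite -[f]compf1 A0 compf0].
Qed.

(** Conjugation by [i] and [p] embeds [End Y] in a local corner of [End X]. A biproduct splits the
    unity there into two elements with zero products; one is a unit and forces the other to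
    vanish. *)
Lemma retract_local_indecomposable X Y (i : hom Y X) (p : hom X Y) :
  p \oc i = idm Y -> local_idem (i \oc p : End X) -> indecomposable Y.
Proof.
move=> pi le; have ip0 := local_idem_neq0 le.
split=> [/zero_objectP Y0|A B [iA [iB [pA [pB [AA BB AB BA sAB]]]]]].
  by apply: ip0; rewrite -[p]comp1f Y0 comp0f compf0.
pose lift (f : End Y) : End X := i \oc f \oc p.
have liftM f g : lift (f * g) = lift f * lift g.
  by rewrite /lift /GRing.mul /= /End_mul !compA -(compA _ p i) pi compf1.
have liftD f g : lift (f + g) = lift f + lift g.
  by rewrite /lift compDr compDl.
have lift1 : lift 1 = i \oc p by rewrite /lift compf1.
have zero_of D (iD : hom D Y) (pD : hom Y D) : pD \oc iD = idm D ->
    iD \oc pD = 0 -> is_zero_object D.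
  move=> DD D0; apply/zero_objectP.
  by rewrite -[LHS]comp1f -{1}DD -[idm D]DD compA -(compA pD) D0 compf0 comp0f.
have lift_inj f : lift f = 0 -> f = 0.
  move=> f0; rewrite -[f]comp1f -[f]compf1 -pi -!compA (compA i) (compA _ p).
  by rewrite -/(lift f) f0 comp0f compf0.
pose a : End Y := iA \oc pA; pose b : End Y := iB \oc pB.
have ab : a * b = 0.
  by rewrite /a /b /GRing.mul /= /End_mul compA -(compA iA) AB compf0 comp0f.
have ba : b * a = 0.
  by rewrite /a /b /GRing.mul /= /End_mul compA -(compA iB) BA compf0 comp0f.
have cor f : (i \oc p : End X) * lift f * (i \oc p : End X) = lift f.
  by rewrite -lift1 -!liftM mul1r mulr1.
case: (local_idem_add le (cor a) (cor b)).
- by rewrite -liftD -[RHS]lift1; congr (lift _); exact: sAB.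
- move=> [u [_ _ ua]]; right; apply: (zero_of _ iB pB BB); apply: lift_inj.
  rewrite -/b -[lift b]cor -ua -!mulrA (mulrA (lift a)) -liftM ab.
  by rewrite {1}/lift compf0 comp0f mul0r mulr0.
- move=> [u [_ _ ub]]; left; apply: (zero_of _ iA pA AA); apply: lift_inj.
  rewrite -/a -[lift a]cor -ub -!mulrA (mulrA (lift b)) -liftM ba.
  by rewrite {1}/lift compf0 comp0f mul0r mulr0.
Qed.

Lemma retract_idem X Y (i : hom Y X) (p : hom X Y) :
  p \oc i = idm Y -> (i \oc p) \oc (i \oc p) = i \oc p.
Proof. by move=> pi; rewrite compA -(compA i) pi compf1. Qed.

Hypothesis paC : pseudo_abelian C.

(** Splitting both [q] and [idm Y - q] exhibits [Y] as a biproduct, one side of which must be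
    zero. *)
Lemma indecomposable_idem Y (q : hom Y Y) : indecomposable Y ->
  q \oc q = q -> q = 0 \/ q = idm Y.
Proof.
move=> [_ iY] qq; have [A [iA [pA [Aq AA]]]] := paC qq.
have qq' : (idm Y - q) \oc (idm Y - q) = idm Y - q.
  by rewrite compDl !compDr !compNf !compfN !comp1f compf1 qq opprK addNr addr0.
have [B [iB [pB [Bq BB]]]] := paC qq'.
have pq : pA \oc q = pA by rewrite -Aq compA AA comp1f.
have qi : q \oc iA = iA by rewrite -Aq -compA AA compf1.
have [|/zero_objectP A0|/zero_objectP B0] := iY A B.
- exists iA, iB, pA, pB; split=> //; last by rewrite Aq Bq addrC subrK.
  + rewrite -pq -[iB]compf1 -BB (compA iB) Bq -!compA (compA q) compDr.
    by rewrite compf1 compfN qq subrr comp0f compf0.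
  + rewrite -qi -[pB]comp1f -BB -(compA pB) Bq -!compA (compA _ q) compDl.
    by rewrite comp1f compNf qq subrr comp0f compf0.
- by left; rewrite -Aq -[iA]compf1 A0 compf0 comp0f.
- right; apply/esym/eqP; rewrite -subr_eq0 -Bq.
  by rewrite -[iB]compf1 B0 compf0 comp0f.
Qed.

(** An idempotent [q] below [i \oc p] is recovered from the idempotent [p \oc q \oc i] of [Y]. *)
Lemma retract_indecomposable_primitive X Y (i : hom Y X) (p : hom X Y) :
  p \oc i = idm Y -> indecomposable Y -> primitive_idem (i \oc p : End X).
Proof.
move=> pi iY q; rewrite /GRing.mul /= /End_mul => qq eq qe.
have qE : q = i \oc (p \oc q \oc i) \oc p.
  by rewrite -{1}qe -{1}eq !compA.
have [||q0|q1] := @indecomposable_idem Y (p \oc q \oc i) => //.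
- by rewrite !compA -(compA _ i p) -(compA _ (i \oc p)) eq -(compA p) qq.
- by left; rewrite qE q0 compf0 comp0f.
- by right; rewrite qE q1 compf1.
Qed.

Lemma idem_equiv_isomorphic X Y Y' (i : hom Y X) (p : hom X Y)
    (i' : hom Y' X) (p' : hom X Y') :
  p \oc i = idm Y -> p' \oc i' = idm Y' ->
  idem_equiv (i \oc p : End X) (i' \oc p' : End X) -> isomorphic Y Y'.
Proof.
move=> pi pi' [a [b []]]; rewrite /GRing.mul /= /End_mul => ha hb ab ba.
have ag : a \oc (i' \oc p') = a by rewrite -ha -compA (retract_idem pi').
have be : b \oc (i \oc p) = b by rewrite -hb -compA (retract_idem pi).
exists (p' \oc b \oc i), (p \oc a \oc i'); split.
  rewrite !compA -(compA _ i') -(compA p) ag -(compA p) ab.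
  by rewrite compA pi comp1f.
rewrite !compA -(compA _ i) -(compA p') be -(compA p') ba.
by rewrite compA pi' comp1f.
Qed.

Lemma direct_sum_ortho t (Y : 'I_t -> C) X (i : forall k, hom (Y k) X)
    (p : forall k, hom X (Y k)) :
  (forall k, p k \oc i k = idm (Y k)) ->
  (forall k l, k != l -> p k \oc i l = 0) ->
  ortho_idem (fun k => i k \oc p k : End X).
Proof.
move=> h1 h2 k l; rewrite [LHS]/GRing.mul /= /End_mul compA -(compA (i k)).
case: eqVneq => [<-|kl]; first by rewrite h1 compf1.
by rewrite h2 // compf0 comp0f.
Qed.

(** Splitting the local idempotents of [End X] produces the summands; any other decomposition gives
    primitive idempotents, which [azumaya] matches with them. *)
Lemma semiperfect_krull_schmidt :
  (forall X, semiperfect (End X)) -> krull_schmidt C.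
Proof.
move=> spC; split=> // X; have /semiperfectP [t [e [oe e1 le]]] := spC X.
have [Y {}eY] := choice (fun k => paC (local_idem_idem (le k))).
have [i {}eY] := dep_choice eY; have [p {}eY] := dep_choice eY.
have ip k : i k \oc p k = e k by case: (eY k).
have pi k : p k \oc i k = idm (Y k) by case: (eY k).
exists t, Y; split.
- by move=> k; apply: (retract_local_indecomposable (pi k)); rewrite ip.
- exists i, p; split=> // [k l kl|]; last by under eq_bigr do rewrite ip.
  have pe : p k \oc e k = p k by rewrite -ip compA pi comp1f.
  have ei : e l \oc i l = i l by rewrite -ip -compA pi compf1.
  have ekl : e k \oc e l = 0 by have := oe k l; rewrite (negPf kl).
  by rewrite -pe -ei -compA (compA (e k)) ekl comp0f compf0.
move=> t' Y' iY' [i' [p' [pi' pi0' sum']]].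
have og := direct_sum_ortho pi' pi0'.
have pg j := retract_indecomposable_primitive (pi' j) (iY' j).
have g0 j : (i' j \oc p' j : End X) <> 0.
  move=> gj; case: (iY' j) => + _; apply; apply/zero_objectP.
  by rewrite -[LHS]comp1f -{1}pi' -[idm _]pi' compA -(compA (p' j)) gj compf0 comp0f.
have eg : idem_equiv (\sum_k e k) (\sum_j (i' j \oc p' j : End X)).
  rewrite e1; have -> : \sum_j (i' j \oc p' j : End X) = 1 by exact: sum'.
  by apply: idem_equiv_refl; rewrite mulr1.
have le' k : e k <> 0 -> local_idem (e k) by [].
have e0 k : e k <> 0 := local_idem_neq0 (le k).
have t't : (0 < t)%N -> (0 < t')%N.
  move=> t0; rewrite lt0n; apply/eqP => t'0; subst t'; apply: (e0 (Ordinal t0)).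
  by rewrite -[LHS]mulr1 -[1]sum' big_ord0 mulr0.
suff [s [sb sY]] : exists s : 'I_t -> 'I_t', bijective s /\
    forall k, idem_equiv (e k) (i' (s k) \oc p' (s k) : End X).
  split; first by have := bij_eq_card sb; rewrite !card_ord.
  exists s; split=> // k; apply: (idem_equiv_isomorphic (pi k) (pi' (s k))).
  by rewrite ip.
have [s [sP sI sS]] : exists s : 'I_t -> 'I_t', [/\ forall k,
    idem_equiv (e k) (i' (s k) \oc p' (s k) : End X), injective s &
    forall j, exists k, s k = j].
  (* [azumaya] takes a default index, so [t' = 0] is treated apart; then ['I_t] is empty as well. *)
  case: (posnP t') => [t'0|t'0].
    have tF (k : 'I_t) : False.
      by have := t't (leq_ltn_trans (leq0n k) (ltn_ord k)); rewrite t'0.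
    exists (fun k => match tF k with end).
    by split=> [k|k|j]; [case: (tF k)|case: (tF k)|case: j; rewrite t'0].
  have [s [sP sI sS]] := azumaya (Ordinal t'0) oe og le' pg eg.
  exists s; split=> [k|k l|j]; first exact: (sP k (e0 k)).2.
    by apply: sI; rewrite inE; apply/eqP.
  by have [k _ sk] := sS j (g0 j); exists k.
exists s; split=> //; have [s' s'K] := choice sS.
by exists s' => // k; apply: sI.
Qed.

End KrullSchmidt.

(** * Hausdorff endomorphism rings, sums and spans *)

Lemma hausdorff_ltEnd (C : ltCat) (X : C) :
  hausdorff_ltCat C -> hausdorff_space (ltEnd X).
Proof.
move=> hC p q pq; apply/eqP; rewrite -subr_eq0; apply/eqP.
have : (\bigcap_(I in lt_ideals (lt_top C)) I X X) (p - q); last by rewrite hC.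
move=> I II.
have [||g [/= gp gq]] := pq [set g : ltEnd X | I X X (g - p)]
  [set g : ltEnd X | I X X (g - q)].
- by exists I.
- by exists I.
have -> : p - q = (g - q) - (g - p) by rewrite opprB [RHS]addrC subrKA.
exact: idealB.
Qed.

Lemma fmap_sum (C D : addCat) (F : addFunctor C D) (X Y : C) (J : finType)
    (f : J -> hom X Y) : fmap F (\sum_j f j) = \sum_j fmap F (f j).
Proof. by apply: (big_morph (fmap F)) => [x y|]; rewrite ?fmap0 ?fmapD. Qed.

Lemma comp_suml (C : preaddCat) (X Y Z : C) (J : finType) (g : J -> hom Y Z)
    (f : hom X Y) : (\sum_j g j) \oc f = \sum_j (g j \oc f).
Proof. by apply: (big_morph (comp^~ f)) => [x y|]; rewrite ?comp0f ?compDl. Qed.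

Lemma comp_sumr (C : preaddCat) (X Y Z : C) (J : finType) (g : hom Y Z)
    (f : J -> hom X Y) : g \oc (\sum_j f j) = \sum_j (g \oc f j).
Proof. by apply: (big_morph (comp g)) => [x y|]; rewrite ?compf0 ?compDr. Qed.

Lemma add_span_subgroup (V : zmodType) (A : set V) : is_subgroup (add_span A).
Proof.
split=> [B [[B0 _] _] //|x y Ax Ay B hB]; have [[_ BB] _] := hB.
by apply: BB; [exact: Ax|exact: Ay].
Qed.

Lemma add_span_sum (V : zmodType) (A : set V) (J : finType) (x : J -> V) :
  (forall j, A (x j)) -> add_span A (\sum_j x j).
Proof.
move=> hx; have [S0 SB] := add_span_subgroup A.
apply: (big_ind (add_span A)) => // [a b Aa Ab|j _].
  by rewrite -[b]opprK -[- b]add0r; apply: (SB) => //; exact: SB.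
by move=> B [_]; apply.
Qed.

(** * Matrices over the vertex rings and the equation at one edge *)

Section Edge.
Variables (Q : quiver) (R : ltRealization Q) (rho : repCat R).

Definition vEnd (v : vertex Q) : ltRingType :=
  ltEnd (rep_obj rho v : vltCat R v).

Definition rep_val (v : vertex Q) (f : ltEnd (rho : repLTCat R)) : vEnd v :=
  rep_hom_val f v.

Fact rep_val_zmod v : zmod_morphism (rep_val v).
Proof. by []. Qed.
Fact rep_val_monoid v : monoid_morphism (rep_val v).
Proof. by []. Qed.
HB.instance Definition _ v :=
  GRing.isZmodMorphism.Build _ _ (rep_val v) (rep_val_zmod v).
HB.instance Definition _ v :=
  GRing.isMonoidMorphism.Build _ _ (rep_val v) (rep_val_monoid v).

Variable n : nat.
Variable alpha : edge Q.
Let f := rep_map rho alpha.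
Let T := tgtF R alpha.
Let S := srcF R alpha.
Let D' := vEnd (tgt alpha).
Let D := vEnd (src alpha).

(* The matrix [T(A) (f I_n) S(B)]. *)
Definition edge_act (A : 'M[D']_n) (B : 'M[D]_n) :
    'M[hom (S (rep_obj rho (src alpha))) (T (rep_obj rho (tgt alpha)))]_n :=
  \matrix_(i, j) \sum_k (fmap T (A i k) \oc f \oc fmap S (B k j)).

(** A family of matrices satisfying this at every edge is a matrix over End(rho), see
    [rep_mx_lift]. *)
Definition edge_comm (A : 'M[D']_n) (B : 'M[D]_n) : Prop :=
  forall i j, fmap T (A i j) \oc f = f \oc fmap S (B i j).

Lemma edge_act1r A i j : edge_act A 1 i j = fmap T (A i j) \oc f.
Proof.
rewrite mxE (bigD1 j) //= big1 => [|k kj]; rewrite mxE ?eqxx ?(negPf kj).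
  by rewrite addr0 [X in _ \oc X](fmap1 S) compf1.
by rewrite [X in _ \oc X](fmap0 S) compf0.
Qed.

Lemma edge_act1l B i j : edge_act 1 B i j = f \oc fmap S (B i j).
Proof.
rewrite mxE (bigD1 i) //= big1 => [|k ki]; rewrite mxE ?eqxx 1?eq_sym ?(negPf ki).
  by rewrite addr0 [X in X \oc _ \oc _](fmap1 T) comp1f.
by rewrite [X in X \oc _ \oc _](fmap0 T) !comp0f.
Qed.

Lemma edge_commP A B : edge_comm A B <-> edge_act A 1 = edge_act 1 B.
Proof.
split=> [AB|AB i j]; first by apply/matrixP => i j; rewrite edge_act1r edge_act1l.
by rewrite -edge_act1r AB edge_act1l.
Qed.

(** The edge equation lets a factor slide across [f] from the target side to the source side. *)
Lemma edge_actM A A' B B' : edge_comm A' B' ->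
  edge_act (A * A') B = edge_act A (B' * B).
Proof.
move=> AB; apply/matrixP => i j; rewrite !mxE.
under eq_bigr do rewrite mxE [fmap T _]fmap_sum !comp_suml.
under [RHS]eq_bigr do rewrite mxE [fmap S _]fmap_sum comp_sumr.
rewrite exchange_big; apply: eq_bigr => l _; apply: eq_bigr => k _.
rewrite (fmap_comp T (A i l) (A' l k)) (fmap_comp S (B' l k) (B k j)).
by rewrite -(compA (fmap T (A i l))) AB !compA.
Qed.

Lemma edge_actX A A' B B' k : edge_comm A' B' ->
  edge_act (A * A' ^+ k) B = edge_act A (B' ^+ k * B).
Proof.
move=> AB; elim: k A B => [|k IH] A B; first by rewrite !expr0 mulr1 mul1r.
by rewrite exprSr mulrA (edge_actM _ _ AB) IH exprSr mulrA.
Qed.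

Lemma edge_actBl A A' B : edge_act (A - A') B = edge_act A B - edge_act A' B.
Proof.
apply/matrixP => i j; rewrite !mxE -sumrB; apply: eq_bigr => k _.
by rewrite !mxE [fmap T _]fmapD [fmap T (- _)]fmapN !compDl !compNf.
Qed.

Lemma edge_actBr A B B' : edge_act A (B - B') = edge_act A B - edge_act A B'.
Proof.
apply/matrixP => i j; rewrite !mxE -sumrB; apply: eq_bigr => k _.
by rewrite !mxE [fmap S _]fmapD [fmap S (- _)]fmapN !compDr !compfN.
Qed.

Hypothesis hausR : hausdorff_realization R.

(** A factor with entries in [I'] or [I] puts every entry of the product in one of the two spans of
    [edge_subgroup]. The factorization may vary with the ideals. *)
Lemma edge_act_eq0 A B :
  (forall I I', lt_ideals (vtop R (src alpha)) I ->
      lt_ideals (vtop R (tgt alpha)) I' ->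
    (exists A' B', edge_act A B = edge_act A' B' /\ forall i j, I' _ _ (A' i j)) \/
    (exists A' B', edge_act A B = edge_act A' B' /\ forall i j, I _ _ (B' i j))) ->
  edge_act A B = 0.
Proof.
move=> hI; apply/matrixP => i j; rewrite [RHS]mxE.
have [_ /(_ alpha (rep_obj rho (src alpha)) (rep_obj rho (tgt alpha)))] := hausR.
move=> h; rewrite -[_ = 0]/([set 0] _) -h => I II I' II'.
have [[A' [B' [-> hA]]]|[A' [B' [-> hB]]]] := hI I I' II II'; rewrite mxE.
  eexists; last first.
    exists 0; first exact: (add_span_subgroup _).1.
    exact: addr0.
  apply: add_span_sum => k; exists (A' i k) => //.
  by eexists; last by rewrite -compA.
exists 0; first exact: (add_span_subgroup _).1.
eexists; last exact: add0r.
by apply: add_span_sum => k; eexists=> //; exists (B' k j).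
Qed.

Lemma vEnd_cvg v (M : nat -> 'M[vEnd v]_n) I : M @ \oo --> (0 : 'M[vEnd v]_n) ->
  lt_ideals (vtop R v) I ->
  exists N, forall k, (N <= k)%N -> forall i j, I _ _ (M k i j).
Proof.
move=> /mx_cvg0 cM II; apply: (cM (I _ _)).
by exists I => // g /=; rewrite subr0.
Qed.

Lemma fitting_edge_comm a' e' b' a e b :
  edge_comm a' a ->
  [/\ e' * e' = e', e' * b' * e' = b', a' * b' = e' /\ b' * a' = e',
     e' * a' = a' * e' &
     (fun k => (1 - e') * a' ^+ k * (1 - e')) @ \oo --> (0 : 'M[D']_n)] ->
  [/\ e * e = e, e * b * e = b, a * b = e /\ b * a = e, e * a = a * e &
     (fun k => (1 - e) * a ^+ k * (1 - e)) @ \oo --> (0 : 'M[D]_n)] ->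
  edge_comm e' e /\ edge_comm b' b.
Proof.
move=> ca [ee' hb' [ab' ba'] ea' cv'] [ee hb [ab ba] ea cv].
have e1 : edge_act (1 - e') e = 0.
  apply: edge_act_eq0 => I I' II II'; left.
  have [N /(_ N (leqnn N)) hN] := vEnd_cvg cv' II'.
  (* Here [e] is written as [a ^+ N * (b ^+ N * e)] and [a ^+ N] slides over to the target side as
     [a' ^+ N]. *)
  exists ((1 - e') * a' ^+ N * (1 - e')), (b ^+ N * e); split=> //.
  rewrite (compl_idem_pow N ee' ea').1 (edge_actX _ _ _ ca).
  by have [-> _] := fitting_split_pow N ee hb ab ba.
have e2 : edge_act e' (1 - e) = 0.
  apply: edge_act_eq0 => I I' II II'; right.
  have [N /(_ N (leqnn N)) hN] := vEnd_cvg cv II.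
  exists (e' * b' ^+ N), ((1 - e) * a ^+ N * (1 - e)); split=> //.
  rewrite (compl_idem_pow N ee ea).2 -(edge_actX _ _ _ ca).
  by have [_ ->] := fitting_split_pow N ee' hb' ab' ba'.
have ce : edge_comm e' e.
  apply/edge_commP; apply/eqP; rewrite -subr_eq0; apply/eqP.
  (* The common term [edge_act e' e] cancels. *)
  transitivity (edge_act e' (1 - e) - edge_act (1 - e') e).
    by rewrite edge_actBr edge_actBl opprB addrA subrK.
  by rewrite e1 e2 subr0.
have [eb be] := corner_absorb ee hb; have [eb' be'] := corner_absorb ee' hb'.
split=> //.
(* In [b' * e'] the factor [e'] crosses as [e = a * b], then [a] returns to form [b' * a' = e'],
   which crosses to give [e * b = b]. *)
apply/edge_commP; rewrite -be' (edge_actM _ _ ce) mulr1 -ab -(edge_actM _ _ ca) ba'.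
by rewrite -[e']mul1r (edge_actM _ _ ce) eb.
Qed.

End Edge.

(** * Descent from the vertices to representations *)

Section RepEnd.
Variables (Q : quiver) (R : ltRealization Q).

Lemma rep_val_eq (rho : repLTCat R) (f g : ltEnd rho) :
  (forall v, rep_val v f = rep_val v g) -> f = g.
Proof. exact: rep_homP. Qed.

Lemma rep_mx_eq (rho : repLTCat R) n (A B : 'M[ltEnd rho]_n) :
  (forall v, map_mx (@rep_val _ _ rho v) A = map_mx (@rep_val _ _ rho v) B) -> A = B.
Proof.
move=> AB; apply/matrixP => i j; apply: rep_val_eq => v.
by have /matrixP/(_ i j) := AB v; rewrite !mxE.
Qed.

Lemma rep_mx_lift (rho : repLTCat R) n (A : forall v, 'M[vEnd rho v]_n) :
  (forall alpha, edge_comm (A (tgt alpha)) (A (src alpha))) ->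
  exists M : 'M[ltEnd rho]_n, forall v, map_mx (@rep_val _ _ rho v) M = A v.
Proof.
move=> cA.
have hA i j : is_rep_hom (fun v => A v i j : hom (rep_obj rho v) (rep_obj rho v)).
  by move=> alpha; exact: cA.
exists (\matrix_(i, j) (RepHom (hA i j) : ltEnd rho)) => v.
by apply/matrixP => i j; rewrite !mxE.
Qed.

Lemma hausdorff_repLTCat : hausdorff_realization R -> hausdorff_ltCat (repLTCat R).
Proof.
move=> [hausV _] X Y; apply/seteqP; split=> [f fI|_ -> I _]; last first.
  exact: (ideal_subgroup I X Y).1.
apply: rep_homP => v.
have : (\bigcap_(I in lt_ideals (vtop R v)) I (rep_obj X v) (rep_obj Y v))
    (rep_hom_val f v).
  (* To test a single ideal [I] at [v], it is completed to a family by arbitrary ideals at the other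
     vertices. *)
  move=> I II; have [J JJ] := dep_choice (fun v => lt_nonempty (vtop R v)).
  have : rep_ideals (rep_ideal (@eqtype.dfwith _ _ J v I)).
    by exists (@eqtype.dfwith _ _ J v I) => // w; case: eqtype.dfwithP.
  by move=> /fI /(_ v); rewrite eqtype.dfwith_in.
by rewrite (hausV v).
Qed.

(** Idempotents split vertex by vertex, with edge map [T(p) f S(i)]; since [e] satisfies the edge
    equations, so do [i] and [p]. *)
Lemma pseudo_abelian_rep : pseudo_abelian_realization R -> pseudo_abelian (repCat R).
Proof.
move=> paR X e ee.
have ev v : rep_hom_val e v \oc rep_hom_val e v = rep_hom_val e v.
  by rewrite -[RHS](congr1 (fun h => rep_hom_val h v) ee).
have [S hS] := dep_choice (fun v => paR v _ _ (ev v)).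
have [i {}hS] := dep_choice hS; have [p {}hS] := dep_choice hS.
have ip v : i v \oc p v = rep_hom_val e v by case: (hS v).
have pi v : p v \oc i v = idm (S v) by case: (hS v).
pose Y : rep R := @Rep _ _ S (fun a =>
  fmap (tgtF R a) (p (tgt a)) \oc rep_map X a \oc fmap (srcF R a) (i (src a))).
have ir : @is_rep_hom _ _ Y X i.
  move=> a; rewrite /= !compA -fmap_comp ip rep_hom_valP -compA -fmap_comp.
  by rewrite -ip -compA pi compf1.
have pr : @is_rep_hom _ _ X Y p.
  move=> a; rewrite /= -!compA -fmap_comp ip -rep_hom_valP compA -fmap_comp.
  by rewrite -ip compA pi comp1f.
exists Y, (RepHom ir), (RepHom pr).
by split; apply: rep_homP => v /=; [exact: ip|exact: pi].
Qed.

Hypothesis hausR : hausdorff_realization R.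
Hypothesis fitR : forall v (C : vltCat R v), fitting_property (ltEnd C).

Lemma fitting_rep (rho : repLTCat R) : fitting_property (ltEnd rho).
Proof.
split; first exact/hausdorff_ltEnd/hausdorff_repLTCat.
move=> n n1 a; pose av v := map_mx (@rep_val _ _ rho v) a.
(* The inverse is chosen along with the idempotent, as both have to be lifted. *)
have fv v : exists eb : 'M[vEnd rho v]_n * 'M[vEnd rho v]_n,
    [/\ eb.1 * eb.1 = eb.1, eb.1 * eb.2 * eb.1 = eb.2,
        av v * eb.2 = eb.1 /\ eb.2 * av v = eb.1, eb.1 * av v = av v * eb.1 &
        (fun k => (1 - eb.1) * av v ^+ k * (1 - eb.1)) @ \oo -->
          (0 : 'M[vEnd rho v]_n)].
  have [e [ee [eE /(fitting_split eE) [b [hb ab ba ea]] cv]]] :=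
    (fitR (rep_obj rho v : vltCat R v)).2 n n1 (av v).
  by exists (e, b).
have [eb ebP] := dep_choice fv.
have ca alpha : edge_comm (av (tgt alpha)) (av (src alpha)).
  by move=> i j; rewrite !mxE; exact: rep_hom_valP.
have ceb alpha :=
  fitting_edge_comm hausR (ca alpha) (ebP (tgt alpha)) (ebP (src alpha)).
have [e eP] := @rep_mx_lift rho n (fun v => (eb v).1) (fun alpha => (ceb alpha).1).
have [b bP] := @rep_mx_lift rho n (fun v => (eb v).2) (fun alpha => (ceb alpha).2).
have ee : e * e = e.
  by apply: rep_mx_eq => v; rewrite map_mxM eP; case: (ebP v).
have ea : e * a = a * e.
  by apply: rep_mx_eq => v; rewrite !map_mxM eP; case: (ebP v).
have hb : e * b * e = b.
  by apply: rep_mx_eq => v; rewrite !map_mxM eP bP; case: (ebP v).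
have ab : a * b = e.
  by apply: rep_mx_eq => v; rewrite !map_mxM eP bP; case: (ebP v) => _ _ [].
have ba : b * a = e.
  by apply: rep_mx_eq => v; rewrite !map_mxM eP bP; case: (ebP v) => _ _ [].
have [aE ua] := fitting_join ee hb ab ba ea.
exists e, ee; split=> //.
apply/mx_cvg0 => U [_ [I II <-] IU].
have hN v : exists N, forall k, (N <= k)%N -> forall i j,
    I v _ _ (((1 - (eb v).1) * av v ^+ k * (1 - (eb v).1)) i j).
  by apply: vEnd_cvg => //; case: (ebP v).
have [N NP] := choice hN.
(* Finiteness of the vertex set yields a common rank. *)
exists (\max_v N v)%N => k Nk i j; apply: IU => v.
have := NP v k (leq_trans (leq_bigmax v) Nk) i j.
have -> : (1 - (eb v).1) * av v ^+ k * (1 - (eb v).1) =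
    map_mx (@rep_val _ _ rho v) ((1 - e) * a ^+ k * (1 - e)).
  have X m : map_mx (@rep_val _ _ rho v) (a ^+ m) = av v ^+ m.
    elim: m => [|m IH]; first by rewrite !expr0 map_mx1.
    by rewrite !exprS map_mxM IH.
  by rewrite !map_mxM map_mxB map_mx1 X eP.
by rewrite mxE subr0.
Qed.

(** The projections [rep_val] are jointly injective into semiperfect rings, which yields primitive
    idempotents; [fitting_rep] makes them local. *)
Lemma semiperfect_rep (rho : repLTCat R) :
  (forall v (C : vltCat R v), semiperfect (ltEnd C)) -> semiperfect (ltEnd rho).
Proof.
move=> spR; apply/semiperfectP.
have [|v|n [g [og g1 g0 pg]]] :=
  @primitive_decomposition_sub (ltEnd rho) _ (vEnd rho) (@rep_val _ _ rho).
- by move=> x x0; apply: rep_val_eq => v; rewrite x0.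
- exact: spR.
exists n, g; split=> // i; apply: primitive_local => //; first exact: fitting_rep.
by rewrite og eqxx.
Qed.

End RepEnd.

Theorem theorem6p2 (Q : quiver) (R : ltRealization Q)
  (hausR : hausdorff_realization R)
  (paR : pseudo_abelian_realization R)
  (endR : forall (v : vertex Q) (C : vltCat R v),
     semiperfect (ltEnd C) /\ fitting_property (ltEnd C)) :
  hausdorff_ltCat (repLTCat R) /\
  pseudo_abelian (repLTCat R) /\
  (forall rho : repLTCat R,
     semiperfect (ltEnd rho) /\ fitting_property (ltEnd rho)) /\
  krull_schmidt (repLTCat R).
Proof.
have spR v (C : vltCat R v) : semiperfect (ltEnd C) by case: (endR v C).
have fitR v (C : vltCat R v) : fitting_property (ltEnd C) by case: (endR v C).
have pa := pseudo_abelian_rep paR.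
have sp (rho : repLTCat R) : semiperfect (ltEnd rho).
  exact: semiperfect_rep.
split; first exact: hausdorff_repLTCat.
split; first exact: pa.
split=> [rho|]; first by split; [exact: sp | exact: fitting_rep].
exact: semiperfect_krull_schmidt.
Qed.
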